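(* Let $k$ be a field of characteristic zero. The two-dimensional Jacobian Conjecture for free Poisson algebras is equivalent to the two-dimensional Jacobian Conjecture for polynomial algebras; that is, the following two assertions are equivalent: (a) every endomorphism $\psi$ of the free Poisson algebra $P=k\{x,y\}$ whose Jacobian matrix $J(\psi)$ is invertible over $P^e$ is an automorphism; (b) every endomorphism of the polynomial algebra $k[x,y]$ whose (classical) Jacobian matrix is invertible over $k[x,y]$ is an automorphism.
   Context: A Poisson algebra over $k$ is a commutative associative algebra with identity $1$ endowed with a Lie bracket $\{x,y\}$ such that $\{x,yz\}=\{x,y\}z+y\{x,z\}$. $k\{x,y\}$ is the free Poisson algebra on $x,y$. For a Poisson algebra $P$, the universal enveloping algebra $P^e$ is the associative unital $k$-algebra generated by two copies $m_P=\{m_a: a\in P\}$, $h_P=\{h_a: a\in P\}$ of the vector space $P$ (with $a\mapsto m_a$, $a\mapsto h_a$ linear) subject to the relations, for all $a,b\in P$: $m_{ab}=m_am_b$, $h_{\{a,b\}}=h_ah_b-h_bh_a$, $h_{ab}=m_bh_a+m_ah_b$, $m_{\{a,b\}}=h_am_b-m_bh_a$, $m_1=1$. The map $a\mapsto m_a$ is injective and $m_a$ is identified with $a$. For $P=k\{x_1,\ldots,x_n\}$, the left ideal $\Omega_P$ of $P^e$ generated by $h_{x_1},\ldots,h_{x_n}$ is a free left $P^e$-module with basis $h_{x_1},\ldots,h_{x_n}$ and contains $h_p$ for all $p\in P$. The Fox derivatives $\frac{\partial p}{\partial x_i}\in P^e$ of $p\in P$ are uniquely defined by $h_p=\frac{\partial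 p}{\partial x_1}h_{x_1}+\cdots+\frac{\partial p}{\partial x_n}h_{x_n}$. For an endomorphism $\psi$ of the Poisson algebra $P$, the Jacobian matrix is $J(\psi)=[u_{ij}]$ with $u_{ij}=\frac{\partial\psi(x_i)}{\partial x_j}$, $1\le i,j\le n$ (here $n=2$, $x_1=x$, $x_2=y$). *)

(* Defs.v *)
From HB Require Import structures.
From mathcomp Require Import all_boot all_algebra ring.
From mathcomp Require Import boolp.
From mathcomp Require Import mpoly.

Set Implicit Arguments.
Unset Strict Implicit.
Unset Printing Implicit Defensive.

Import GRing.Theory.
Local Open Scope ring_scope.
Local Open Scope quotient_scope.

Declare Scope poisson_scope.
Delimit Scope poisson_scope with poisson.
Local Open Scope poisson_scope.

Reserved Notation "\{ a , b }" (at level 0, a at level 99, b at level 99,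
  format "\{ a ,  b }").

HB.mixin Record isPoisson (k : fieldType) P of GRing.ComAlgebra k P := {
  pbr : P -> P -> P;
  pbrDl : forall a b c, pbr (a + b) c = pbr a c + pbr b c;
  pbrDr : forall a b c, pbr a (b + c) = pbr a b + pbr a c;
  pbrZl : forall (t : k) a b, pbr (t *: a) b = t *: pbr a b;
  pbrZr : forall (t : k) a b, pbr a (t *: b) = t *: pbr a b;
  pbrxx : forall a, pbr a a = 0;
  pbr_jacobi : forall a b c,
    pbr a (pbr b c) + pbr b (pbr c a) + pbr c (pbr a b) = 0;
  pbrMr : forall a b c, pbr a (b * c) = pbr a b * c + b * pbr a c
}.

#[short(type="poissonType")]
HB.structure Definition Poisson (k : fieldType) :=
  {P of isPoisson k P & GRing.ComAlgebra k P}.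

Notation "\{ a , b }" := (pbr a b) : poisson_scope.

HB.mixin Record isPoissonMorphism (k : fieldType) (P Q : poissonType k)
    (f : P -> Q) := {
  pbr_morph : forall a b, f \{a, b} = \{f a, f b}
}.

HB.structure Definition PoissonMorphism (k : fieldType) (P Q : poissonType k) :=
  {f of isPoissonMorphism k P Q f & @GRing.LRMorphism k P Q *:%R f}.

Notation "{ 'pmorphism' P -> Q }" := (PoissonMorphism.type P%type Q%type)
  (at level 0, P at level 98, Q at level 99,
   format "{ 'pmorphism'  P  ->  Q }") : type_scope.

Section PoissonTheory.
Variables (k : fieldType) (P : poissonType k).
Implicit Types a b c : P.

Lemma pbrC a b : \{a, b} = - \{b, a}.
Proof.
apply/eqP; rewrite -addr_eq0; apply/eqP.
have := pbrxx (a + b); rewrite pbrDl !pbrDr !pbrxx addr0 add0r.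
by [].
Qed.

Lemma pbr0 a : \{a, 0} = 0.
Proof. by rewrite -(scale0r (0 : P)) pbrZr !scale0r. Qed.

Lemma pbrMl a b c : \{a * b, c} = a * \{b, c} + b * \{a, c}.
Proof.
rewrite pbrC pbrMr (pbrC c a) (pbrC c b) mulNr mulrN opprD !opprK.
by rewrite addrC (mulrC b).
Qed.

Lemma pbr1 a : \{a, 1} = 0.
Proof.
have := pbrMr a 1 1; rewrite !mulr1 mul1r => /eqP.
by rewrite -subr_eq0 opprD addNKr oppr_eq0 => /eqP.
Qed.

Lemma pbr_scalar a t : \{a, t%:A} = 0.
Proof. by rewrite pbrZr pbr1 scaler0. Qed.

Lemma pbr_der a b c : \{\{a, b}, c} = \{a, \{b, c}} - \{b, \{a, c}}.
Proof.
have /eqP := pbr_jacobi a b c.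
rewrite addr_eq0 => /eqP E; rewrite pbrC -E (pbrC c a).
by rewrite -!scaleN1r pbrZr.
Qed.

End PoissonTheory.

(* The free Poisson algebra on x_0, ..., x_(n-1) is the type of formal
   expressions modulo the congruence generated by the Poisson algebra axioms;
   [PConst c] stands for the scalar multiple c 1 of the unit. *)
Inductive pterm (k : Type) (n : nat) : Type :=
  | PVar of 'I_n
  | PConst of k
  | PAdd of pterm k n & pterm k n
  | PMul of pterm k n & pterm k n
  | PBr of pterm k n & pterm k n.

Arguments PVar {k n}.
Arguments PConst {k n}.

HB.instance Definition _ k n := gen_eqMixin (pterm k n).
HB.instance Definition _ k n := gen_choiceMixin (pterm k n).

Section PoissonCongruence.
Variables (k : fieldType) (n : nat).

Local Infix "+p" := (@PAdd k n) (at level 50, left associativity).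
Local Infix "*p" := (@PMul k n) (at level 40, left associativity).
Local Notation "[p s , t ]" := (@PBr k n s t) (at level 0).
Local Notation "c %:p" := (@PConst k n c) (at level 2, format "c %:p").

Inductive pcong : pterm k n -> pterm k n -> Prop :=
  | pcong_refl s : pcong s s
  | pcong_sym s t : pcong s t -> pcong t s
  | pcong_trans s t r : pcong s t -> pcong t r -> pcong s r
  | pcong_add s s' t t' : pcong s s' -> pcong t t' -> pcong (s +p t) (s' +p t')
  | pcong_mul s s' t t' : pcong s s' -> pcong t t' -> pcong (s *p t) (s' *p t')
  | pcong_br s s' t t' : pcong s s' -> pcong t t' -> pcong [p s, t] [p s', t']
  | pcong_addA s t r : pcong (s +p (t +p r)) (s +p t +p r)
  | pcong_addC s t : pcong (s +p t) (t +p s)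
  | pcong_add0 s : pcong (0%:p +p s) s
  | pcong_mulA s t r : pcong (s *p (t *p r)) (s *p t *p r)
  | pcong_mulC s t : pcong (s *p t) (t *p s)
  | pcong_mul1 s : pcong (1%:p *p s) s
  | pcong_mulD s t r : pcong ((s +p t) *p r) (s *p r +p t *p r)
  | pcong_mul0 s : pcong (0%:p *p s) 0%:p
  | pcong_constD c d : pcong (c + d)%:p (c%:p +p d%:p)
  | pcong_constM c d : pcong (c * d)%:p (c%:p *p d%:p)
  | pcong_brDl s t r : pcong [p s +p t, r] ([p s, r] +p [p t, r])
  | pcong_brDr s t r : pcong [p s, t +p r] ([p s, t] +p [p s, r])
  | pcong_brZl c s t : pcong [p c%:p *p s, t] (c%:p *p [p s, t])
  | pcong_brZr c s t : pcong [p s, c%:p *p t] (c%:p *p [p s, t])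
  | pcong_brxx s : pcong [p s, s] 0%:p
  | pcong_jacobi s t r :
      pcong ([p s, [p t, r]] +p [p t, [p r, s]] +p [p r, [p s, t]]) 0%:p
  | pcong_leibniz s t r :
      pcong [p s, t *p r] ([p s, t] *p r +p t *p [p s, r]).

Definition pcongb s t := `[< pcong s t >].

Lemma pcongb_equiv : equiv_class_of pcongb.
Proof.
split=> [s | s t | t s r].
- by apply/asboolP; apply: pcong_refl.
- by apply/asboolP/asboolP; apply: pcong_sym.
- by move=> /asboolP st /asboolP tr; apply/asboolP; apply: pcong_trans tr.
Qed.

Canonical pcong_equiv := EquivRelPack pcongb_equiv.

Definition freePoisson := {eq_quot pcong_equiv}.
HB.instance Definition _ : EqQuotient _ pcong_equiv freePoisson :=
  EqQuotient.on freePoisson.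
HB.instance Definition _ := Choice.on freePoisson.

Lemma freePoisson_eqP s t : \pi_freePoisson s = \pi t <-> pcong s t.
Proof. by split=> [/eqmodP /asboolP | st] //; apply/eqmodP/asboolP. Qed.

Lemma pcong_repr s : pcong (repr (\pi_freePoisson s)) s.
Proof. by apply/freePoisson_eqP; rewrite reprK. Qed.

Implicit Types a b c : freePoisson.

Definition fp_const (c : k) : freePoisson := \pi c%:p.
Definition fp_add a b : freePoisson := \pi_freePoisson (repr a +p repr b).
Definition fp_mul a b : freePoisson := \pi_freePoisson (repr a *p repr b).
Definition fp_br a b : freePoisson := \pi [p repr a, repr b].
Definition fp_opp a : freePoisson := fp_mul (fp_const (- 1)) a.
Definition fp_scale (c : k) a : freePoisson := fp_mul (fp_const c) a.

Lemma fp_add_pi s t : fp_add (\pi s) (\pi t) = \pi_freePoisson (s +p t).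
Proof. by apply/freePoisson_eqP/pcong_add; apply: pcong_repr. Qed.
Lemma fp_mul_pi s t : fp_mul (\pi s) (\pi t) = \pi_freePoisson (s *p t).
Proof. by apply/freePoisson_eqP/pcong_mul; apply: pcong_repr. Qed.
Lemma fp_br_pi s t : fp_br (\pi s) (\pi t) = \pi [p s, t].
Proof. by apply/freePoisson_eqP/pcong_br; apply: pcong_repr. Qed.
Let piE := (fp_add_pi, fp_mul_pi, fp_br_pi).

Lemma fp_addA : associative fp_add.
Proof.
elim/quotW=> s; elim/quotW=> t; elim/quotW=> r.
by rewrite !piE; apply/freePoisson_eqP/pcong_addA.
Qed.
Lemma fp_addC : commutative fp_add.
Proof.
elim/quotW=> s; elim/quotW=> t.
by rewrite !piE; apply/freePoisson_eqP/pcong_addC.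
Qed.
Lemma fp_add0 : left_id (fp_const 0) fp_add.
Proof. by elim/quotW=> s; rewrite !piE; apply/freePoisson_eqP/pcong_add0. Qed.
Lemma fp_mulA : associative fp_mul.
Proof.
elim/quotW=> s; elim/quotW=> t; elim/quotW=> r.
by rewrite !piE; apply/freePoisson_eqP/pcong_mulA.
Qed.
Lemma fp_mulC : commutative fp_mul.
Proof.
elim/quotW=> s; elim/quotW=> t.
by rewrite !piE; apply/freePoisson_eqP/pcong_mulC.
Qed.
Lemma fp_mul1 : left_id (fp_const 1) fp_mul.
Proof. by elim/quotW=> s; rewrite !piE; apply/freePoisson_eqP/pcong_mul1. Qed.
Lemma fp_mulDl : left_distributive fp_mul fp_add.
Proof.
elim/quotW=> s; elim/quotW=> t; elim/quotW=> r.
by rewrite !piE; apply/freePoisson_eqP/pcong_mulD.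
Qed.
Lemma fp_mul0 a : fp_mul (fp_const 0) a = fp_const 0.
Proof.
by elim/quotW: a => s; rewrite !piE; apply/freePoisson_eqP/pcong_mul0.
Qed.
Lemma fp_constD (c d : k) : fp_const (c + d) = fp_add (fp_const c) (fp_const d).
Proof. by rewrite !piE; apply/freePoisson_eqP/pcong_constD. Qed.
Lemma fp_constM (c d : k) : fp_const (c * d) = fp_mul (fp_const c) (fp_const d).
Proof. by rewrite !piE; apply/freePoisson_eqP/pcong_constM. Qed.
Lemma fp_addN : left_inverse (fp_const 0) fp_opp fp_add.
Proof.
move=> a; rewrite -{2}[a]fp_mul1 /fp_opp -fp_mulDl -fp_constD addNr.
exact: fp_mul0.
Qed.

Fixpoint pterm_aug (t : pterm k n) : k := match t with
  | PVar _ => 0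
  | PConst c => c
  | PAdd s r => pterm_aug s + pterm_aug r
  | PMul s r => pterm_aug s * pterm_aug r
  | PBr _ _ => 0
  end.

Lemma pterm_augP s t : pcong s t -> pterm_aug s = pterm_aug t.
Proof. by elim=> //=; move=> *; subst; (congruence || ring). Qed.

Lemma fp_oner_neq0 : fp_const 1 != fp_const 0.
Proof.
apply/eqP=> /freePoisson_eqP /pterm_augP /eqP; apply/negP; exact: oner_neq0.
Qed.

HB.instance Definition _ :=
  GRing.isZmodule.Build freePoisson fp_addA fp_addC fp_add0 fp_addN.
HB.instance Definition _ :=
  GRing.Zmodule_isComNzRing.Build freePoisson
    fp_mulA fp_mulC fp_mul1 fp_mulDl fp_oner_neq0.

Lemma fp_scaleA (c d : k) a : fp_scale c (fp_scale d a) = fp_scale (c * d) a.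
Proof. by rewrite /fp_scale fp_constM fp_mulA. Qed.
Lemma fp_scaleDr : right_distributive fp_scale +%R.
Proof. by move=> c a b; apply: (mulrDr (fp_const c : freePoisson)). Qed.
Lemma fp_scaleDl a : {morph fp_scale^~ a : c d / c + d}.
Proof. by move=> c d; rewrite /fp_scale fp_constD; apply: fp_mulDl. Qed.

HB.instance Definition _ :=
  GRing.Zmodule_isLmodule.Build k freePoisson
    fp_scaleA fp_mul1 fp_scaleDr fp_scaleDl.

Lemma fp_scaleAl (c : k) a b : c *: (a * b) = c *: a * b.
Proof. exact: fp_mulA. Qed.

HB.instance Definition _ :=
  GRing.Lmodule_isLalgebra.Build k freePoisson fp_scaleAl.
HB.instance Definition _ :=
  GRing.Lalgebra_isComAlgebra.Build k freePoisson.

Lemma fp_scale_pi (c : k) s : c *: \pi_freePoisson s = \pi_freePoisson (c%:p *p s).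
Proof. exact: fp_mul_pi. Qed.
Lemma fp_brDl a b c : fp_br (a + b) c = fp_br a c + fp_br b c.
Proof.
elim/quotW: a => s; elim/quotW: b => t; elim/quotW: c => r.
rewrite /GRing.add /= !piE; apply/freePoisson_eqP/pcong_brDl.
Qed.
Lemma fp_brDr a b c : fp_br a (b + c) = fp_br a b + fp_br a c.
Proof.
elim/quotW: a => s; elim/quotW: b => t; elim/quotW: c => r.
by rewrite /GRing.add /= !piE; apply/freePoisson_eqP/pcong_brDr.
Qed.
Lemma fp_brZl (c : k) a b : fp_br (c *: a) b = c *: fp_br a b.
Proof.
elim/quotW: a => s; elim/quotW: b => t.
rewrite fp_scale_pi !fp_br_pi fp_scale_pi.
by apply/freePoisson_eqP/pcong_brZl.
Qed.
Lemma fp_brZr (c : k) a b : fp_br a (c *: b) = c *: fp_br a b.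
Proof.
elim/quotW: a => s; elim/quotW: b => t.
rewrite fp_scale_pi !fp_br_pi fp_scale_pi.
by apply/freePoisson_eqP/pcong_brZr.
Qed.
Lemma fp_brxx a : fp_br a a = 0.
Proof.
by elim/quotW: a => s; rewrite !piE; apply/freePoisson_eqP/pcong_brxx.
Qed.
Lemma fp_jacobi a b c :
  fp_br a (fp_br b c) + fp_br b (fp_br c a) + fp_br c (fp_br a b) = 0.
Proof.
elim/quotW: a => s; elim/quotW: b => t; elim/quotW: c => r.
by rewrite /GRing.add /= !piE; apply/freePoisson_eqP/pcong_jacobi.
Qed.
Lemma fp_brMr a b c : fp_br a (b * c) = fp_br a b * c + b * fp_br a c.
Proof.
elim/quotW: a => s; elim/quotW: b => t; elim/quotW: c => r.
by rewrite /GRing.add /GRing.mul /= !piE; apply/freePoisson_eqP/pcong_leibniz.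
Qed.

HB.instance Definition _ := isPoisson.Build k freePoisson
  fp_brDl fp_brDr fp_brZl fp_brZr fp_brxx fp_jacobi fp_brMr.

Definition fp_gen (i : 'I_n) : freePoisson := \pi_freePoisson (PVar i).

Lemma fp_piE :
  [/\ forall c : k, \pi_freePoisson c%:p = c%:A,
      forall s t, \pi_freePoisson (s +p t) = (\pi s : freePoisson) + (\pi t : freePoisson),
      forall s t, \pi_freePoisson (s *p t) = (\pi s : freePoisson) * (\pi t : freePoisson) &
      forall s t,
        \pi_freePoisson [p s, t] = \{(\pi s : freePoisson), (\pi t : freePoisson)}].
Proof.
split=> [c | s t | s t | s t]; first 1 last.
- exact/esym/fp_add_pi.
- exact/esym/fp_mul_pi.
- exact/esym/fp_br_pi.
by symmetry; rewrite -[LHS]/(fp_mul (fp_const c) (fp_const 1)) fp_mulC fp_mul1.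
Qed.

Lemma freePoisson_ind (S : freePoisson -> Prop) :
  (forall i, S (fp_gen i)) -> (forall c : k, S c%:A) ->
  (forall a b, S a -> S b -> S (a + b)) ->
  (forall a b, S a -> S b -> S (a * b)) ->
  (forall a b, S a -> S b -> S \{a, b}) ->
  forall a, S a.
Proof.
have [cE DE ME BE] := fp_piE => Sx Sc SD SM SB; elim/quotW.
elim=> [i | c | s Hs t Ht | s Hs t Ht | s Hs t Ht]; first exact: Sx.
- by rewrite cE.
- by rewrite DE; apply: SD.
- by rewrite ME; apply: SM.
- by rewrite BE; apply: SB.
Qed.

Section Lift.
Variables (Q : poissonType k) (g : 'I_n -> Q).

Fixpoint pterm_eval (t : pterm k n) : Q := match t with
  | PVar i => g i
  | PConst c => c%:A
  | PAdd s r => pterm_eval s + pterm_eval r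
  | PMul s r => pterm_eval s * pterm_eval r
  | PBr s r => \{pterm_eval s, pterm_eval r}
  end.

Lemma pterm_evalP s t : pcong s t -> pterm_eval s = pterm_eval t.
Proof.
elim=> //=; intros; subst; try congruence.
- by rewrite addrA.
- by rewrite addrC.
- by rewrite scale0r add0r.
- by rewrite mulrA.
- by rewrite mulrC.
- by rewrite scale1r mul1r.
- by rewrite mulrDl.
- by rewrite scale0r mul0r.
- by rewrite scalerDl.
- by rewrite -scalerAl mul1r scalerA.
- by rewrite pbrDl.
- by rewrite pbrDr.
- by rewrite -!scalerAl !mul1r pbrZl.
- by rewrite -!scalerAl !mul1r pbrZr.
- by rewrite pbrxx scale0r.
- by rewrite pbr_jacobi scale0r.
- by rewrite pbrMr.
Qed.

Definition fp_lift (a : freePoisson) : Q := pterm_eval (repr a).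

Lemma fp_lift_pi s : fp_lift (\pi s) = pterm_eval s.
Proof. exact/pterm_evalP/pcong_repr. Qed.

Lemma fp_lift_gen i : fp_lift (fp_gen i) = g i.
Proof. exact: fp_lift_pi. Qed.

Lemma fp_lift_is_morphism :
  [/\ forall c : k, fp_lift c%:A = c%:A,
      {morph fp_lift : a b / a + b},
      {morph fp_lift : a b / a * b} &
      {morph fp_lift : a b / \{a, b}}].
Proof.
have [cE DE ME BE] := fp_piE.
split=> [c | | | ]; first by rewrite -cE fp_lift_pi.
- by elim/quotW=> s; elim/quotW=> t; rewrite -DE !fp_lift_pi.
- by elim/quotW=> s; elim/quotW=> t; rewrite -ME !fp_lift_pi.
- by elim/quotW=> s; elim/quotW=> t; rewrite -BE !fp_lift_pi.
Qed.

Fact fp_lift_is_linear : linear fp_lift.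
Proof.
have [cE DE ME _] := fp_lift_is_morphism.
by move=> c a b; rewrite DE -[c *: a]mulr_algl ME cE mulr_algl.
Qed.
HB.instance Definition _ :=
  GRing.isLinear.Build k freePoisson Q *:%R fp_lift fp_lift_is_linear.

Fact fp_lift_is_monoid_morphism : monoid_morphism fp_lift.
Proof.
have [cE _ ME _] := fp_lift_is_morphism.
by split=> //; rewrite -[1]scale1r cE scale1r.
Qed.
HB.instance Definition _ :=
  GRing.isMonoidMorphism.Build freePoisson Q fp_lift
    fp_lift_is_monoid_morphism.

Fact fp_lift_br a b : fp_lift \{a, b} = \{fp_lift a, fp_lift b}.
Proof. by have [_ _ _ ->] := fp_lift_is_morphism. Qed.
HB.instance Definition _ :=
  isPoissonMorphism.Build k freePoisson Q fp_lift fp_lift_br.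

Lemma fp_lift_unique (f : {pmorphism freePoisson -> Q}) :
  (forall i, f (fp_gen i) = g i) -> f =1 fp_lift.
Proof.
move=> fg; apply: freePoisson_ind => [i | c | a b fa fb | a b fa fb | a b fa fb].
- by rewrite fg fp_lift_gen.
- by rewrite !rmorph_alg.
- by rewrite !rmorphD /= fa fb.
- by rewrite !rmorphM /= fa fb.
- by rewrite !pbr_morph fa fb.
Qed.

End Lift.

End PoissonCongruence.

Arguments fp_gen {k n}.

(* The universal enveloping algebra of P is presented by generators and
   relations: [UConst c] stands for c 1, and the relations down to [ucong_constC]
   are those of associative unital k-algebras. *)
Inductive uterm (k P : Type) : Type :=
  | UM of P
  | UH of P
  | UConst of k
  | UAdd of uterm k P & uterm k P
  | UMul of uterm k P & uterm k P.

Arguments UM {k P}.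
Arguments UH {k P}.
Arguments UConst {k P}.

HB.instance Definition _ k P := gen_eqMixin (uterm k P).
HB.instance Definition _ k P := gen_choiceMixin (uterm k P).

Section Enveloping.
Variables (k : fieldType) (P : poissonType k).

Local Infix "+u" := (@UAdd k P) (at level 50, left associativity).
Local Infix "*u" := (@UMul k P) (at level 40, left associativity).
Local Notation "c %:u" := (@UConst k P c) (at level 2, format "c %:u").
Local Notation m := (@UM k P).
Local Notation h := (@UH k P).

Inductive ucong : uterm k P -> uterm k P -> Prop :=
  | ucong_refl s : ucong s s
  | ucong_sym s t : ucong s t -> ucong t s
  | ucong_trans s t r : ucong s t -> ucong t r -> ucong s r
  | ucong_add s s' t t' : ucong s s' -> ucong t t' -> ucong (s +u t) (s' +u t')
  | ucong_mul s s' t t' : ucong s s' -> ucong t t' -> ucong (s *u t) (s' *u t')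
  | ucong_addA s t r : ucong (s +u (t +u r)) (s +u t +u r)
  | ucong_addC s t : ucong (s +u t) (t +u s)
  | ucong_add0 s : ucong (0%:u +u s) s
  | ucong_mulA s t r : ucong (s *u (t *u r)) (s *u t *u r)
  | ucong_mul1 s : ucong (1%:u *u s) s
  | ucong_mulDl s t r : ucong ((s +u t) *u r) (s *u r +u t *u r)
  | ucong_mulDr s t r : ucong (s *u (t +u r)) (s *u t +u s *u r)
  | ucong_mul0 s : ucong (0%:u *u s) 0%:u
  | ucong_constD c d : ucong (c + d)%:u (c%:u +u d%:u)
  | ucong_constM c d : ucong (c * d)%:u (c%:u *u d%:u)
  | ucong_constC c s : ucong (c%:u *u s) (s *u c%:u)
  | ucong_mD a b : ucong (m (a + b)) (m a +u m b)
  | ucong_mZ c a : ucong (m (c *: a)) (c%:u *u m a)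
  | ucong_hD a b : ucong (h (a + b)) (h a +u h b)
  | ucong_hZ c a : ucong (h (c *: a)) (c%:u *u h a)
  | ucong_mM a b : ucong (m (a * b)) (m a *u m b)
  | ucong_hbr a b :
      ucong (h \{a, b}) (h a *u h b +u (- 1)%:u *u (h b *u h a))
  | ucong_hM a b : ucong (h (a * b)) (m b *u h a +u m a *u h b)
  | ucong_mbr a b :
      ucong (m \{a, b}) (h a *u m b +u (- 1)%:u *u (m b *u h a))
  | ucong_m1 : ucong (m 1) 1%:u.

Definition ucongb s t := `[< ucong s t >].

Lemma ucongb_equiv : equiv_class_of ucongb.
Proof.
split=> [s | s t | t s r].
- by apply/asboolP; apply: ucong_refl.
- by apply/asboolP/asboolP; apply: ucong_sym.
- by move=> /asboolP st /asboolP tr; apply/asboolP; apply: ucong_trans tr.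
Qed.

Canonical ucong_equiv := EquivRelPack ucongb_equiv.

Definition envelope := {eq_quot ucong_equiv}.
HB.instance Definition _ : EqQuotient _ ucong_equiv envelope :=
  EqQuotient.on envelope.
HB.instance Definition _ := Choice.on envelope.

Lemma envelope_eqP s t : \pi_envelope s = \pi t <-> ucong s t.
Proof. by split=> [/eqmodP /asboolP | st] //; apply/eqmodP/asboolP. Qed.

Lemma ucong_repr s : ucong (repr (\pi_envelope s)) s.
Proof. by apply/envelope_eqP; rewrite reprK. Qed.

Implicit Types u v w : envelope.

Definition env_m (a : P) : envelope := \pi_envelope (m a).
Definition env_h (a : P) : envelope := \pi_envelope (h a).
Definition env_const (c : k) : envelope := \pi_envelope c%:u.
Definition env_add u v : envelope := \pi_envelope (repr u +u repr v).
Definition env_mul u v : envelope := \pi_envelope (repr u *u repr v).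
Definition env_opp u : envelope := env_mul (env_const (- 1)) u.
Definition env_scale (c : k) u : envelope := env_mul (env_const c) u.

Lemma env_add_pi s t : env_add (\pi s) (\pi t) = \pi_envelope (s +u t).
Proof. by apply/envelope_eqP/ucong_add; apply: ucong_repr. Qed.
Lemma env_mul_pi s t : env_mul (\pi s) (\pi t) = \pi_envelope (s *u t).
Proof. by apply/envelope_eqP/ucong_mul; apply: ucong_repr. Qed.
Let piE := (env_add_pi, env_mul_pi).

Lemma env_addA : associative env_add.
Proof.
elim/quotW=> s; elim/quotW=> t; elim/quotW=> r.
by rewrite !piE; apply/envelope_eqP/ucong_addA.
Qed.
Lemma env_addC : commutative env_add.
Proof.
elim/quotW=> s; elim/quotW=> t.
by rewrite !piE; apply/envelope_eqP/ucong_addC.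
Qed.
Lemma env_add0 : left_id (env_const 0) env_add.
Proof. by elim/quotW=> s; rewrite !piE; apply/envelope_eqP/ucong_add0. Qed.
Lemma env_mulA : associative env_mul.
Proof.
elim/quotW=> s; elim/quotW=> t; elim/quotW=> r.
by rewrite !piE; apply/envelope_eqP/ucong_mulA.
Qed.
Lemma env_mul1 : left_id (env_const 1) env_mul.
Proof. by elim/quotW=> s; rewrite !piE; apply/envelope_eqP/ucong_mul1. Qed.
Lemma env_constC c u : env_mul (env_const c) u = env_mul u (env_const c).
Proof.
by elim/quotW: u => s; rewrite !piE; apply/envelope_eqP/ucong_constC.
Qed.
Lemma env_mulr1 : right_id (env_const 1) env_mul.
Proof. by move=> u; rewrite -env_constC env_mul1. Qed.
Lemma env_mulDl : left_distributive env_mul env_add.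
Proof.
elim/quotW=> s; elim/quotW=> t; elim/quotW=> r.
by rewrite !piE; apply/envelope_eqP/ucong_mulDl.
Qed.
Lemma env_mulDr : right_distributive env_mul env_add.
Proof.
elim/quotW=> s; elim/quotW=> t; elim/quotW=> r.
by rewrite !piE; apply/envelope_eqP/ucong_mulDr.
Qed.
Lemma env_mul0 u : env_mul (env_const 0) u = env_const 0.
Proof. by elim/quotW: u => s; rewrite !piE; apply/envelope_eqP/ucong_mul0. Qed.
Lemma env_constD c d : env_const (c + d) = env_add (env_const c) (env_const d).
Proof. by rewrite !piE; apply/envelope_eqP/ucong_constD. Qed.
Lemma env_constM c d : env_const (c * d) = env_mul (env_const c) (env_const d).
Proof. by rewrite !piE; apply/envelope_eqP/ucong_constM. Qed.
Lemma env_addN : left_inverse (env_const 0) env_opp env_add.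
Proof.
move=> u; rewrite -{2}[u]env_mul1 /env_opp -env_mulDl -env_constD addNr.
exact: env_mul0.
Qed.

HB.instance Definition _ :=
  GRing.isZmodule.Build envelope env_addA env_addC env_add0 env_addN.

(* Action of formal expressions on a P-module E, i.e. on the data of maps m_a
   and h_a on E satisfying the defining relations. *)
Section TermAction.
Variables (E : lmodType k) (mu eta : P -> E -> E).

Record is_module : Prop := IsModule {
  muL : forall a, linear (mu a);
  etaL : forall a, linear (eta a);
  mu_lin : forall (c : k) a b e, mu (c *: a + b) e = c *: mu a e + mu b e;
  eta_lin : forall (c : k) a b e, eta (c *: a + b) e = c *: eta a e + eta b e;
  muM : forall a b e, mu (a * b) e = mu a (mu b e);
  eta_br : forall a b e,
    eta \{a, b} e = eta a (eta b e) - eta b (eta a e);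
  etaM : forall a b e, eta (a * b) e = mu b (eta a e) + mu a (eta b e);
  mu_br : forall a b e, mu \{a, b} e = eta a (mu b e) - mu b (eta a e);
  mu1 : forall e, mu 1 e = e
}.

Fixpoint uterm_act (t : uterm k P) (e : E) : E := match t with
  | UM a => mu a e
  | UH a => eta a e
  | UConst c => c *: e
  | UAdd s r => uterm_act s e + uterm_act r e
  | UMul s r => uterm_act s (uterm_act r e)
  end.

Hypothesis modE : is_module.

Lemma uterm_act_linear t : linear (uterm_act t).
Proof.
elim: t => [a | a | c | s IHs r IHr | s IHs r IHr] d e f /=.
- exact: muL.
- exact: etaL.
- by rewrite scalerDr !scalerA mulrC.
- by rewrite IHs IHr scalerDr addrACA.
- by rewrite IHr IHs.
Qed.

Lemma uterm_actP s t : ucong s t -> uterm_act s =1 uterm_act t.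
Proof.
have actD r e f : uterm_act r (e + f) = uterm_act r e + uterm_act r f.
  by have := uterm_act_linear r 1 e f; rewrite !scale1r.
have act0 r : uterm_act r 0 = 0.
  by apply: (addrI (uterm_act r 0)); rewrite -actD !addr0.
have actZ r c e : uterm_act r (c *: e) = c *: uterm_act r e.
  by have := uterm_act_linear r c e 0; rewrite act0 !addr0.
case: modE => _ _ muL etaL muM etaB etaM muB mu1.
elim=> //=; clear s t.
- by move=> s t _ st e; rewrite st.
- by move=> s t r _ st _ tr e; rewrite st tr.
- by move=> s s' t t' _ ss _ tt e; rewrite ss tt.
- by move=> s s' t t' _ ss _ tt e; rewrite ss tt.
- by move=> s t r e; rewrite addrA.
- by move=> s t e; rewrite addrC.
- by move=> s e; rewrite scale0r add0r.
- by move=> s e; rewrite scale1r.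
- by move=> s t r e; rewrite actD.
- by move=> s e; rewrite !scale0r.
- by move=> c d e; rewrite scalerDl.
- by move=> c d e; rewrite scalerA.
- by move=> c s e; rewrite actZ.
- by move=> a b e; have := muL 1 a b e; rewrite !scale1r.
- move=> c a e; have mu0 b : mu 0 b = 0.
    by apply: (addrI (mu 0 b)); have := muL 1 0 0 b; rewrite !scale1r !addr0.
  by have := muL c a 0 e; rewrite mu0 !addr0.
- by move=> a b e; have := etaL 1 a b e; rewrite !scale1r.
- move=> c a e; have eta0 b : eta 0 b = 0.
    by apply: (addrI (eta 0 b)); have := etaL 1 0 0 b; rewrite !scale1r !addr0.
  by have := etaL c a 0 e; rewrite eta0 !addr0.
- by move=> a b e; rewrite etaB scaleN1r.
- by move=> a b e; rewrite muB scaleN1r.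
- by move=> e; rewrite mu1 scale1r.
Qed.

Definition env_act u e := uterm_act (repr u) e.

Lemma env_act_pi s e : env_act (\pi s) e = uterm_act s e.
Proof. exact/uterm_actP/ucong_repr. Qed.

End TermAction.

Fact regular_module :
  is_module (fun a b : P => a * b) (fun a b : P => \{a, b}).
Proof.
split=> //=.
- by move=> a c b d; rewrite mulrDr scalerAr.
- by move=> a c b d; rewrite pbrDr pbrZr.
- by move=> c a b d; rewrite mulrDl scalerAl.
- by move=> c a b d; rewrite pbrDl pbrZl.
- by move=> a b c; rewrite mulrA.
- exact: pbr_der.
- by move=> a b c; rewrite pbrMl addrC.
- by move=> a b c; rewrite pbrMr addrK.
- exact: mul1r.
Qed.

Lemma env_oner_neq0 : env_const 1 != env_const 0.
Proof.
apply/eqP=> /envelope_eqP /(uterm_actP regular_module) /(_ 1) /=.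
by rewrite scale1r scale0r => /eqP; rewrite oner_eq0.
Qed.

HB.instance Definition _ :=
  GRing.Zmodule_isNzRing.Build envelope
    env_mulA env_mul1 env_mulr1 env_mulDl env_mulDr env_oner_neq0.

Lemma env_scaleA c d u : env_scale c (env_scale d u) = env_scale (c * d) u.
Proof. by rewrite /env_scale env_constM env_mulA. Qed.
Lemma env_scaleDr : right_distributive env_scale +%R.
Proof. by move=> c u v; apply: (mulrDr (env_const c : envelope)). Qed.
Lemma env_scaleDl u : {morph env_scale^~ u : c d / c + d}.
Proof. by move=> c d; rewrite /env_scale env_constD; apply: env_mulDl. Qed.

HB.instance Definition _ :=
  GRing.Zmodule_isLmodule.Build k envelope
    env_scaleA env_mul1 env_scaleDr env_scaleDl.

Lemma env_scaleAl (c : k) u v : c *: (u * v) = c *: u * v.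
Proof. exact: env_mulA. Qed.
HB.instance Definition _ :=
  GRing.Lmodule_isLalgebra.Build k envelope env_scaleAl.

Lemma env_scaleAr (c : k) u v : c *: (u * v) = u * (c *: v).
Proof.
rewrite -[LHS]/(env_const c * (u * v)) -[c *: v]/(env_const c * v).
rewrite !mulrA; congr (_ * _); exact: env_constC.
Qed.
HB.instance Definition _ :=
  GRing.Lalgebra_isAlgebra.Build k envelope env_scaleAr.

Lemma env_constE c : env_const c = c%:A.
Proof. by rewrite -[RHS]/(env_const c * 1) mulr1. Qed.

Lemma env_piD s t : \pi_envelope (s +u t) = (\pi s : envelope) + (\pi t : envelope).
Proof. exact/esym/env_add_pi. Qed.
Lemma env_piM s t : \pi_envelope (s *u t) = (\pi s : envelope) * (\pi t : envelope).
Proof. exact/esym/env_mul_pi. Qed.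
Lemma env_piN s t :
  \pi_envelope (s +u (- 1)%:u *u t) = (\pi s : envelope) - (\pi t : envelope).
Proof. by rewrite env_piD env_piM -/(env_const _) env_constE scaleN1r mulN1r. Qed.

Fact env_m_linear : linear env_m.
Proof.
move=> c a b; rewrite -[c *: env_m a]mulr_algl -env_constE.
transitivity (env_m (c *: a) + env_m b).
  by rewrite -env_piD; apply/envelope_eqP/ucong_mD.
by congr (_ + _); rewrite -env_piM; apply/envelope_eqP/ucong_mZ.
Qed.
HB.instance Definition _ :=
  GRing.isLinear.Build k P envelope *:%R env_m env_m_linear.

Fact env_h_linear : linear env_h.
Proof.
move=> c a b; rewrite -[c *: env_h a]mulr_algl -env_constE.
transitivity (env_h (c *: a) + env_h b).
  by rewrite -env_piD; apply/envelope_eqP/ucong_hD.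
by congr (_ + _); rewrite -env_piM; apply/envelope_eqP/ucong_hZ.
Qed.
HB.instance Definition _ :=
  GRing.isLinear.Build k P envelope *:%R env_h env_h_linear.

Fact env_m_monoid_morphism : monoid_morphism env_m.
Proof.
split=> [|a b]; first exact/envelope_eqP/ucong_m1.
by rewrite -env_piM; apply/envelope_eqP/ucong_mM.
Qed.
HB.instance Definition _ :=
  GRing.isMonoidMorphism.Build P envelope env_m env_m_monoid_morphism.

Lemma env_h_br a b : env_h \{a, b} = env_h a * env_h b - env_h b * env_h a.
Proof. by rewrite -!env_piM -env_piN; apply/envelope_eqP/ucong_hbr. Qed.
Lemma env_hM a b : env_h (a * b) = env_m b * env_h a + env_m a * env_h b.
Proof. by rewrite -!env_piM -env_piD; apply/envelope_eqP/ucong_hM. Qed.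
Lemma env_m_br a b : env_m \{a, b} = env_h a * env_m b - env_m b * env_h a.
Proof. by rewrite -!env_piM -env_piN; apply/envelope_eqP/ucong_mbr. Qed.

Lemma envelope_ind (S : envelope -> Prop) :
  (forall a, S (env_m a)) -> (forall a, S (env_h a)) -> (forall c : k, S c%:A) ->
  (forall u v, S u -> S v -> S (u + v)) ->
  (forall u v, S u -> S v -> S (u * v)) ->
  forall u, S u.
Proof.
move=> Sm Sh Sc SD SM; elim/quotW.
elim=> [a | a | c | s Hs t Ht | s Hs t Ht].
- exact: Sm.
- exact: Sh.
- by rewrite -/(env_const c) env_constE.
- by rewrite env_piD; apply: SD.
- by rewrite env_piM; apply: SM.
Qed.

Section Action.
Variables (E : lmodType k) (mu eta : P -> E -> E).
Hypothesis modE : is_module mu eta.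
Local Notation act := (env_act mu eta).

Lemma env_act_m a e : act (env_m a) e = mu a e.
Proof. exact: env_act_pi. Qed.
Lemma env_act_h a e : act (env_h a) e = eta a e.
Proof. exact: env_act_pi. Qed.
Lemma env_act_const c e : act (c%:A) e = c *: e.
Proof. by rewrite -env_constE; apply: env_act_pi. Qed.
Lemma env_actD u v e : act (u + v) e = act u e + act v e.
Proof.
by elim/quotW: u => s; elim/quotW: v => t; rewrite -env_piD !(env_act_pi modE).
Qed.
Lemma env_actM u v e : act (u * v) e = act u (act v e).
Proof.
by elim/quotW: u => s; elim/quotW: v => t; rewrite -env_piM !(env_act_pi modE).
Qed.
Lemma env_act_linear u : linear (act u).
Proof. exact: uterm_act_linear. Qed.

End Action.

Lemma env_m_inj : injective env_m.
Proof.
move=> a b /(congr1 (fun u => env_act *%R (@pbr k P) u 1)).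
by rewrite !(env_act_m regular_module) !mulr1.
Qed.

End Enveloping.

Section Fox.
Variables (k : fieldType) (n : nat).
Local Notation P := (freePoisson k n).
Local Notation U := (envelope P).
Local Notation cl := (\pi_(freePoisson k n)).

(* Coordinate j of the derivation of P into the free left module of rank n over
   the enveloping algebra that sends the generators to the standard basis. *)
Fixpoint pterm_fox (j : 'I_n) (t : pterm k n) : U := match t with
  | PVar i => (i == j)%:R
  | PConst _ => 0
  | PAdd s r => pterm_fox j s + pterm_fox j r
  | PMul s r =>
      env_m (cl s : P) * pterm_fox j r + env_m (cl r : P) * pterm_fox j s
  | PBr s r =>
      env_h (cl s : P) * pterm_fox j r - env_h (cl r : P) * pterm_fox j s
  end.

Lemma pterm_foxP j s t : pcong s t -> pterm_fox j s = pterm_fox j t.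
Proof.
have [cE DE ME BE] := fp_piE k n.
elim=> //=; clear s t.
- by move=> s t r _ -> _ ->.
- by move=> s s' t t' _ -> _ ->.
- by move=> s s' t t' /freePoisson_eqP-> -> /freePoisson_eqP-> ->.
- by move=> s s' t t' /freePoisson_eqP-> -> /freePoisson_eqP-> ->.
- by move=> s t r; rewrite addrA.
- by move=> s t; rewrite addrC.
- by move=> s; rewrite add0r.
- move=> s t r; rewrite !ME !rmorphM /= !mulrDr !mulrA addrA.
  by rewrite -!rmorphM /= (mulrC (cl r : P) (cl s)) (mulrC (cl r : P) (cl t)).
- by move=> s t; rewrite addrC.
- by move=> s; rewrite cE scale1r rmorph1 mul1r mulr0 addr0.
- by move=> s t r; rewrite DE rmorphD /= mulrDl mulrDr addrACA.
- by move=> s; rewrite cE scale0r rmorph0 mul0r mulr0 addr0.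
- by rewrite addr0.
- by move=> *; rewrite !mulr0 addr0.
- by move=> s t r; rewrite DE raddfD /= mulrDl mulrDr opprD addrACA.
- by move=> s t r; rewrite DE raddfD /= mulrDl mulrDr opprD addrACA.
- move=> c s t; rewrite ME cE mulr_algl !linearZ /= !mulr0 !addr0 rmorph1.
  by rewrite !mulr_algl scalerBr -scalerAr !scalerAl.
- move=> c s t; rewrite ME cE mulr_algl !linearZ /= !mulr0 !addr0 rmorph1.
  by rewrite !mulr_algl scalerBr -scalerAr !scalerAl.
- by move=> s; rewrite subrr.
- move=> s t r; rewrite !BE !env_h_br !mulrBl !mulrBr !mulrA !opprB !addrA.
  rewrite [LHS](ACl ((1*12)*(2*7)*(3*10)*(4*5)*(6*11)*(8*9)))/=.
  by rewrite !(addNr, subrr) !addr0.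
- move=> s t r; rewrite ME !BE !env_hM !env_m_br !mulrBl !mulrBr.
  rewrite !mulrDl !mulrDr !mulrA.
  rewrite opprD !addrA [RHS](ACl (1*7*4*6*(2*5)*(3*8)))/=.
  by rewrite addNr subrr !addr0.
Qed.

Let foxc j (p : P) : U := pterm_fox j (repr p).

Let foxc_pi j s : foxc j (cl s) = pterm_fox j s.
Proof. exact/pterm_foxP/pcong_repr. Qed.

Let foxc_gen j i : foxc j (fp_gen i) = (i == j)%:R.
Proof. exact: foxc_pi. Qed.

Let foxc_alg j (c : k) : foxc j c%:A = 0.
Proof. by have [<- _ _ _] := fp_piE k n; rewrite foxc_pi. Qed.

Let foxcD j (a b : P) : foxc j (a + b) = foxc j a + foxc j b.
Proof.
have [_ E _ _] := fp_piE k n.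
by elim/quotW: a => s; elim/quotW: b => t; rewrite -E !foxc_pi.
Qed.

Let foxcM j (a b : P) :
  foxc j (a * b) = env_m a * foxc j b + env_m b * foxc j a.
Proof.
have [_ _ E _] := fp_piE k n.
by elim/quotW: a => s; elim/quotW: b => t; rewrite -E !foxc_pi.
Qed.

Let foxc_br j (a b : P) :
  foxc j \{a, b} = env_h a * foxc j b - env_h b * foxc j a.
Proof.
have [_ _ _ E] := fp_piE k n.
by elim/quotW: a => s; elim/quotW: b => t; rewrite -E !foxc_pi.
Qed.

Let foxcZ j (c : k) (a : P) : foxc j (c *: a) = c *: foxc j a.
Proof.
by rewrite -mulr_algl foxcM foxc_alg mulr0 addr0 rmorph_alg mulr_algl.
Qed.

Lemma env_h1 (Q : poissonType k) : env_h (1 : Q) = 0.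
Proof.
have := env_hM (1 : Q) 1; rewrite mulr1 rmorph1 !mul1r => /eqP.
by rewrite -subr_eq0 opprD addNKr oppr_eq0 => /eqP.
Qed.

(* The left ideal generated by the h_(x_i) contains all the h_p. *)
Lemma fox_exists (p : P) :
  exists u : 'I_n -> U, env_h p = \sum_(i < n) u i * env_h (fp_gen i).
Proof.
exists (foxc^~ p); elim/freePoisson_ind: p => [i | c | a b Ha Hb | a b Ha Hb | a b Ha Hb].
- rewrite (bigD1 i) //= foxc_gen eqxx mul1r big1 ?addr0 // => j /negbTE ji.
  by rewrite foxc_gen eq_sym ji mul0r.
- by rewrite linearZ /= env_h1 scaler0 big1 // => j _; rewrite foxc_alg mul0r.
- rewrite raddfD /= Ha Hb -big_split; apply: eq_bigr => j _.
  by rewrite foxcD mulrDl.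
- rewrite env_hM addrC Ha Hb !mulr_sumr -big_split; apply: eq_bigr => j _ /=.
  by rewrite foxcM mulrDl !mulrA.
- rewrite env_h_br {1}Hb {2}Ha !mulr_sumr -sumrB; apply: eq_bigr => j _ /=.
  by rewrite foxc_br mulrBl !mulrA.
Qed.

(* Coordinate j of the module structure on the extension of the P-module P by
   the free module of rank n which is defined by the derivation above. *)
Let ext_m (a : P) (e : U * P) : U * P := (env_m a * e.1, a * e.2).
Let ext_h j (a : P) (e : U * P) : U * P :=
  (env_h a * e.1 + env_m e.2 * foxc j a, \{a, e.2}).

Let ext_module j : is_module ext_m (ext_h j).
Proof.
have pairZ (c : k) (x y : U * P) : c *: x + y = (c *: x.1 + y.1, c *: x.2 + y.2).
  by [].
have pairB (x y : U * P) : x - y = (x.1 - y.1, x.2 - y.2) by [].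
split; rewrite /ext_m /ext_h.
- by move=> a c x y; rewrite !pairZ /= !mulrDr -!scalerAr.
- move=> a c x y; rewrite !pairZ /= pbrDr pbrZr; congr pair.
  by rewrite mulrDr linearP /= mulrDl scalerDr -scalerAr -scalerAl addrACA.
- by move=> c a b x; rewrite !pairZ /= linearP /= !mulrDl -!scalerAl.
- move=> c a b x; rewrite !pairZ /= linearP /= pbrDl pbrZl; congr pair.
  by rewrite foxcD foxcZ mulrDl mulrDr scalerDr -scalerAr -scalerAl addrACA.
- by move=> a b x /=; rewrite rmorphM !mulrA.
- move=> a b x; rewrite pairB /= pbr_der; congr pair.
  rewrite env_h_br foxc_br !env_m_br !mulrBl !mulrBr !mulrDr !mulrA.
  rewrite !opprD opprK !addrA [RHS](ACl (1*5*8*4*(2*7)*(3*6)))/=.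
  by rewrite !subrr !addr0.
- move=> a b x /=; congr pair; last by rewrite pbrMl addrC.
  rewrite env_hM foxcM !mulrDl !mulrDr !mulrA addrACA -!rmorphM /=.
  by rewrite (mulrC b) (mulrC a) addrACA [RHS]addrACA (addrC (_ * foxc j a)).
- move=> a b x; rewrite pairB /= pbrMr addrK; congr pair.
  rewrite env_m_br mulrBl mulrDr opprD !mulrA -!rmorphM /= addrACA.
  by rewrite subrr addr0.
- by move=> [u p] /=; rewrite rmorph1 !mul1r.
Qed.

Let ext_act j u v : env_act ext_m (ext_h j) u (v, 0) = (u * v, 0).
Proof.
elim/envelope_ind: u v => [a | a | c | u w Hu Hw | u w Hu Hw] v.
- by rewrite (env_act_m (ext_module j)) /ext_m mulr0.
- by rewrite (env_act_h (ext_module j)) /ext_h /= pbr0 raddf0 mul0r addr0.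
- by rewrite (env_act_const (ext_module j)) mulr_algl -[LHS]/(_, _) scaler0.
- rewrite (env_actD (ext_module j)) Hu Hw -[LHS]/(_, _) addr0.
  by rewrite mulrDl.
- by rewrite (env_actM (ext_module j)) Hw Hu mulrA.
Qed.

(* The h_(x_i) are left linearly independent. *)
Lemma fox_unique (u v : 'I_n -> U) :
  \sum_(i < n) u i * env_h (fp_gen i) = \sum_(i < n) v i * env_h (fp_gen i) ->
  u =1 v.
Proof.
have actE (w : 'I_n -> U) j :
    env_act ext_m (ext_h j) (\sum_(i < n) w i * env_h (fp_gen i)) (0, 1)
      = (w j, 0).
  have act0 : env_act ext_m (ext_h j) 0 (0, 1) = 0.
    by rewrite -(scale0r 1) (env_act_const (ext_module j)) scale0r.
  transitivity (\sum_(i < n) (w i * (i == j)%:R, 0 : P)).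
    elim/big_ind2: _ => // [x x' y y' Hx Hy | i _].
      by rewrite (env_actD (ext_module j)) Hx Hy.
    rewrite (env_actM (ext_module j)) (env_act_h (ext_module j)) /ext_h /=.
    rewrite mulr0 add0r rmorph1 mul1r foxc_gen.
    by rewrite pbr1 ext_act.
  rewrite (bigD1 j) //= eqxx mulr1 big1 ?addr0 // => i /negbTE ->.
  by rewrite mulr0.
by move=> uv j; have := actE v j; rewrite -uv actE => -[].
Qed.

(* The Fox derivatives of p: the unique coordinates of h_p on the h_(x_i). *)
Definition fox (p : P) : 'I_n -> U := sval (cid (fox_exists p)).

Lemma foxP (p : P) : env_h p = \sum_(i < n) fox p i * env_h (fp_gen i).
Proof. by rewrite /fox; case: cid. Qed.

Definition poisson_jacobian (psi : P -> P) : 'M[U]_n :=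
  \matrix_(i < n, j < n) fox (psi (fp_gen i)) j.

End Fox.

(* Over a noncommutative ring, where [unitmx] is not available. *)
Definition mx_invertible (R : pzRingType) (n : nat) (A : 'M[R]_n) : Prop :=
  exists B : 'M[R]_n, A *m B = 1%:M /\ B *m A = 1%:M.

Definition mpoly_jacobian (k : fieldType) (n : nat)
    (phi : {mpoly k[n]} -> {mpoly k[n]}) : 'M[{mpoly k[n]}]_n :=
  \matrix_(i < n, j < n) mderiv j (phi 'X_i).

(* Main.v *)
Require Import Defs.
From mathcomp Require Import all_boot all_algebra mpoly ring boolp.
From HB Require Import structures.
Import GRing.Theory.
Local Open Scope ring_scope.
Local Open Scope quotient_scope.
Local Open Scope poisson_scope.

(* Let X_i = h_(x_i). As a left P-module, P^e is free on the words in the X_i,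
   and the coefficient of h_f at a word w is a derivation of f, namely the
   partial derivative on the polynomial algebra P = Sym(L) along the
   corresponding linear form on the free Lie algebra L. Hence, in
   characteristic zero, f is a polynomial in the x_i as soon as h_f has degree
   at most 1 in the X_i.

   If the Jacobian matrix of psi is invertible, X_0 and X_1 are left
   combinations of h_f and h_g, where f = psi x_0 and g = psi x_1. Suppose that
   h_f or h_g has degree N > 1. Their components of degree N must cancel in
   such a combination, so they are proportional over the domain P and some r =
   a h_f + b h_g with b <> 0 has smaller degree. Up to a scalar of P (Ore
   condition), X_i is a combination of h_f and r, whose leading components p
   and q have different degrees. These are Lie elements, and a Lie element p is
   never a left multiple u q of a Lie element q of smaller degree: dually, the
   Lie elements act as derivations on the shuffle algebra. So no leading terms
   cancel, X_0 and X_1 are both multiples of r, and this is absurd. Hence f and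
   g are polynomials, and psi is induced by an endomorphism of k[x, y] whose
   Jacobian matrix is the one of psi. *)

Set Implicit Arguments.
Unset Strict Implicit.
Unset Printing Implicit Defensive.

(** * Expansion of the elements of the enveloping algebra in words *)

(** A separate type, with functions of arbitrary support, because it will carry the shuffle
    product. *)
Definition wordfun (n : nat) (R : Type) : Type := seq 'I_n -> R.

HB.instance Definition _ n R := gen_eqMixin (wordfun n R).
HB.instance Definition _ n R := gen_choiceMixin (wordfun n R).

Section WordFun.
Variable n : nat.
Local Notation word := (seq 'I_n).

Section Additive.
Variable V : zmodType.
Implicit Types f g h : wordfun n V.

Definition wf_zero : wordfun n V := fun=> 0.
Definition wf_opp f : wordfun n V := fun w => - f w.
Definition wf_add f g : wordfun n V := fun w => f w + g w.

Fact wf_addA : associative wf_add.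
Proof. by move=> f g h; apply/funext=> w; apply: addrA. Qed.
Fact wf_addC : commutative wf_add.
Proof. by move=> f g; apply/funext=> w; apply: addrC. Qed.
Fact wf_add0 : left_id wf_zero wf_add.
Proof. by move=> f; apply/funext=> w; apply: add0r. Qed.
Fact wf_addN : left_inverse wf_zero wf_opp wf_add.
Proof. by move=> f; apply/funext=> w; apply: addNr. Qed.

HB.instance Definition _ :=
  GRing.isZmodule.Build (wordfun n V) wf_addA wf_addC wf_add0 wf_addN.

Lemma wfD f g w : (f + g) w = f w + g w. Proof. by []. Qed.
Lemma wfB f g w : (f - g) w = f w - g w. Proof. by []. Qed.
End Additive.

Section Scale.
Variables (R : pzRingType) (V : lmodType R).
Implicit Types f g : wordfun n V.

Definition wf_scale (c : R) f : wordfun n V := fun w => c *: f w.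

Fact wf_scaleA c d f : wf_scale c (wf_scale d f) = wf_scale (c * d) f.
Proof. by apply/funext=> w; apply: scalerA. Qed.
Fact wf_scale1 : left_id 1 wf_scale.
Proof. by move=> f; apply/funext=> w; apply: scale1r. Qed.
Fact wf_scaleDr : right_distributive wf_scale +%R.
Proof. by move=> c f g; apply/funext=> w; apply: scalerDr. Qed.
Fact wf_scaleDl f : {morph wf_scale^~ f : c d / c + d}.
Proof. by move=> c d; apply/funext=> w; apply: scalerDl. Qed.

HB.instance Definition _ :=
  GRing.Zmodule_isLmodule.Build R (wordfun n V)
    wf_scaleA wf_scale1 wf_scaleDr wf_scaleDl.

Lemma wfZ c f w : (c *: f) w = c *: f w. Proof. by []. Qed.

End Scale.

End WordFun.

(** * Modules over the free Poisson algebra from operators on the generators *)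

Section FreePoissonModule.
Variables (k : fieldType) (n : nat).
Local Notation P := (freePoisson k n).
Local Notation cl := (\pi_(freePoisson k n)).
Variables (E : lmodType k) (mu : P -> E -> E) (X : 'I_n -> E -> E).
Hypotheses (muL : forall a, linear (mu a)) (XL : forall i, linear (X i)).
Hypothesis mu_lin :
  forall (c : k) a b e, mu (c *: a + b) e = c *: mu a e + mu b e.
Hypotheses (muM : forall a b e, mu (a * b) e = mu a (mu b e))
  (mu1 : forall e, mu 1 e = e).
Hypothesis Xmu :
  forall i a e, mu \{fp_gen i, a} e = X i (mu a e) - mu a (X i e).

Let muD a b e : mu (a + b) e = mu a e + mu b e.
Proof. by rewrite -[a]scale1r mu_lin !scale1r. Qed.
Let mu0 e : mu 0 e = 0.
Proof. by apply: (addrI (mu 0 e)); rewrite -muD !addr0. Qed.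
Let muZ c a e : mu (c *: a) e = c *: mu a e.
Proof. by rewrite -[c *: a]addr0 mu_lin mu0 addr0. Qed.
Let muB a b e : mu (a - b) e = mu a e - mu b e.
Proof. by rewrite addrC -scaleN1r mu_lin scaleN1r addrC. Qed.
Let mu_scalar (c : k) e : mu c%:A e = c *: e.
Proof. by rewrite muZ mu1. Qed.
Let muE a c e f : mu a (c *: e + f) = c *: mu a e + mu a f.
Proof. exact: muL. Qed.
Let muDr a e f : mu a (e + f) = mu a e + mu a f.
Proof. by rewrite -[e]scale1r muE !scale1r. Qed.
Let mu0r a : mu a 0 = 0.
Proof. by apply: (addrI (mu a 0)); rewrite -muDr !addr0. Qed.
Let muNr a e : mu a (- e) = - mu a e.
Proof. by apply: (addrI (mu a e)); rewrite -muDr !subrr mu0r. Qed.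
Let muC a b e : mu a (mu b e) = mu b (mu a e).
Proof. by rewrite -!muM mulrC. Qed.

(** The relations of the enveloping algebra force the action of h on every expression once the
    operators [X i] are given. *)
Fixpoint pterm_eta (t : pterm k n) (e : E) : E := match t with
  | PVar i => X i e
  | PConst _ => 0
  | PAdd s r => pterm_eta s e + pterm_eta r e
  | PMul s r => mu (cl r) (pterm_eta s e) + mu (cl s) (pterm_eta r e)
  | PBr s r => pterm_eta s (pterm_eta r e) - pterm_eta r (pterm_eta s e)
  end.

Let pterm_etaL t : linear (pterm_eta t).
Proof.
elim: t => [i | c | s IHs r IHr | s IHs r IHr | s IHs r IHr] c' e f /=.
- exact: XL.
- by rewrite scaler0 addr0.
- by rewrite IHs IHr scalerDr addrACA.
- by rewrite IHs IHr !muE scalerDr addrACA.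
- by rewrite !(IHs, IHr) scalerBr opprD addrACA.
Qed.

Let etaD t e f : pterm_eta t (e + f) = pterm_eta t e + pterm_eta t f.
Proof. by have := pterm_etaL t 1 e f; rewrite !scale1r. Qed.
Let eta0 t : pterm_eta t 0 = 0.
Proof. by apply: (addrI (pterm_eta t 0)); rewrite -etaD !addr0. Qed.
Let etaN t e : pterm_eta t (- e) = - pterm_eta t e.
Proof. by apply: (addrI (pterm_eta t e)); rewrite -etaD !subrr eta0. Qed.
Let etaZ t c e : pterm_eta t (c *: e) = c *: pterm_eta t e.
Proof. by rewrite -[c *: e]addr0 pterm_etaL eta0 addr0. Qed.

(** Extends [Xmu] from the generators to all expressions; the Leibniz clause of the congruence
    depends on it. *)
Let pterm_eta_mu t a e :
  mu \{cl t, a} e = pterm_eta t (mu a e) - mu a (pterm_eta t e).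
Proof.
have [cE DE ME BE] := fp_piE k n.
elim: t a e => [i | c | s IHs r IHr | s IHs r IHr | s IHs r IHr] a e /=.
- exact: Xmu.
- by rewrite cE pbrC pbr_scalar oppr0 mu0 mu0r subr0.
- by rewrite DE pbrDl muD IHs IHr muDr opprD addrACA.
- rewrite ME pbrMl muD !muM IHs IHr !muDr !muNr opprD addrACA.
  by rewrite (muC a (cl r)) (muC a (cl s)) addrC addrACA addrC addrACA
    [LHS]addrC.
- rewrite BE pbr_der muB !(IHs, IHr).
  rewrite !(etaD, etaN, muDr, muNr) !opprD !opprK !addrA.
  rewrite [LHS](ACl (1*5*8*4*(3*6)*(2*7)))/=.
  by rewrite !addNr !addr0.
Qed.

Lemma pterm_etaP s t : pcong s t -> pterm_eta s =1 pterm_eta t.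
Proof.
have [cE DE ME BE] := fp_piE k n.
elim=> //=; clear s t.
- by move=> s t _ st e; rewrite st.
- by move=> s t r _ st _ tr e; rewrite st tr.
- by move=> s s' t t' _ ss _ tt e; rewrite ss tt.
- move=> s s' t t' /freePoisson_eqP ss ss' /freePoisson_eqP tt tt' e.
  by rewrite ss' tt' ss tt.
- by move=> s s' t t' _ ss _ tt e; rewrite !tt !ss.
- by move=> s t r e; rewrite addrA.
- by move=> s t e; rewrite addrC.
- by move=> s e; rewrite add0r.
- move=> s t r e; rewrite !ME !muDr -!muM !addrA.
  by rewrite (mulrC (cl t)) (mulrC (cl r) (cl s)).
- by move=> s t e; rewrite addrC.
- by move=> s e; rewrite cE scale1r mu1 mu0r add0r.
- by move=> s t r e; rewrite DE muD muDr addrACA.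
- by move=> s e; rewrite cE scale0r mu0 mu0r addr0.
- by move=> c d e; rewrite addr0.
- by move=> c d e; rewrite !mu0r addr0.
- by move=> s t r e; rewrite etaD opprD addrACA.
- by move=> s t r e; rewrite etaD opprD addrACA.
- move=> c s t e; rewrite cE !mu0r !add0r !mu_scalar etaZ.
  by rewrite scalerBr.
- move=> c s t e; rewrite cE !mu0r !add0r !mu_scalar etaZ.
  by rewrite scalerBr.
- by move=> s e; rewrite subrr.
- move=> s t r e; rewrite !(etaD, etaN) !opprD !opprK !addrA.
  rewrite [LHS](ACl ((1*11)*(8*2)*(5*3)*(12*6)*(4*10)*(9*7)))/=.
  by rewrite !subrr !addr0.
- move=> s t r e; rewrite !BE !pterm_eta_mu !(etaD, etaN, muDr, muNr).
  rewrite !opprD !addrA.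
  rewrite [RHS](ACl (5*3*2*8*(1*6)*(7*4)))/=.
  by rewrite !subrr !addr0.
Qed.

Definition fp_eta (a : P) : E -> E := pterm_eta (repr a).

Lemma fp_eta_pi t : fp_eta (cl t) =1 pterm_eta t.
Proof. exact/pterm_etaP/pcong_repr. Qed.

Lemma fp_eta_module :
  is_module mu fp_eta /\ forall i, fp_eta (fp_gen i) =1 X i.
Proof.
split; last by move=> i; apply: fp_eta_pi.
have [cE DE ME BE] := fp_piE k n.
split=> //.
- by move=> a; apply: pterm_etaL.
- move=> c a b e; elim/quotW: a => s; elim/quotW: b => t.
  rewrite -mulr_algl -cE -ME -DE !fp_eta_pi /=.
  by rewrite mu0r add0r cE mu_scalar.
- move=> a b e; elim/quotW: a => s; elim/quotW: b => t.
  by rewrite -BE !fp_eta_pi.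
- move=> a b e; elim/quotW: a => s; elim/quotW: b => t.
  by rewrite -ME !fp_eta_pi.
- move=> a b e; elim/quotW: a => s.
  by rewrite pterm_eta_mu !fp_eta_pi.
Qed.

End FreePoissonModule.

(** * Coefficients and degrees with respect to words in the h_(x_i) *)

Section Coefficients.
Variables (k : fieldType) (n : nat).
Local Notation P := (freePoisson k n).
Local Notation U := (envelope P).
Local Notation word := (seq 'I_n).
Local Notation x_ i := (fp_gen i : P).
Local Notation m_ a := (env_m (a : P)).
Local Notation h_ a := (env_h (a : P)).

Lemma envelope_gen_ind (S : U -> Prop) :
  (forall a, S (m_ a)) -> (forall i, S (h_ (x_ i))) ->
  (forall u v, S u -> S v -> S (u + v)) ->
  (forall u v, S u -> S v -> S (u * v)) ->
  forall u, S u.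
Proof.
move=> Sm Sx SD SM.
have Sc (c : k) : S c%:A by rewrite -(rmorph_alg (@env_m k P)); apply: Sm.
apply: envelope_ind => //; elim/freePoisson_ind => [i | c | a b Sa Sb | a b Sa
  Sb | a b Sa Sb].
- exact: Sx.
- by rewrite linearZ /= env_h1 scaler0 -(scale0r 1); apply: Sc.
- by rewrite raddfD; apply: SD.
- by rewrite env_hM; apply: SD; apply: SM.
- rewrite env_h_br; apply: SD; first exact: SM.
  by rewrite -mulN1r; apply: (SM); [rewrite -scaleN1r; apply: Sc | apply: SM].
Qed.

(** Induction on [u] for the stronger claim that [S w] implies [S (u * w)], used at [w = 1]. *)
Lemma envelope_left_ind (S : U -> Prop) :
  S 1 -> (forall a u, S u -> S (m_ a * u)) ->
  (forall i u, S u -> S (h_ (x_ i) * u)) ->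
  (forall u v, S u -> S v -> S (u + v)) -> forall u, S u.
Proof.
move=> S1 Sm Sx SD u; rewrite -[u]mulr1; elim/envelope_gen_ind: u (1) S1 => //.
- by move=> u v IHu IHv w Sw; rewrite mulrDl; apply: SD;
  [apply: IHu | apply: IHv].
- by move=> u v IHu IHv w Sw; rewrite -mulrA; apply/IHu/IHv.
Qed.

Definition wf_mul (a : P) (f : wordfun n P) : wordfun n P := fun w => a * f w.

(** Left multiplication by h_(x_i) on sums of terms a_w h_w: since h_(x_i) a = a h_(x_i) + {x_i, a},
    coefficients are bracketed with x_i and words are prolonged on the left. *)
Definition wf_gen (i : 'I_n) (f : wordfun n P) : wordfun n P := fun w =>
  \{x_ i, f w} + (if w is j :: w' then (j == i)%:R * f w' else 0).

Let wf_mulL a : linear (wf_mul a).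
Proof. by move=> c f g; apply/funext=> w; rewrite /wf_mul mulrDr -scalerAr. Qed.

Let wf_genL i : linear (wf_gen i).
Proof.
move=> c f g; apply/funext=> w; rewrite wfD wfZ /wf_gen.
rewrite wfD wfZ pbrDr pbrZr scalerDr -!addrA; congr (_ + _).
case: w => [|j w]; first by rewrite scaler0 add0r addr0.
by rewrite wfD wfZ mulrDr -scalerAr addrCA.
Qed.

Let word_eta : is_module wf_mul (fp_eta wf_mul wf_gen) /\
  forall i, fp_eta wf_mul wf_gen (fp_gen i) =1 wf_gen i.
Proof.
apply: fp_eta_module => // [c a b f | a b f | f | i a f]; apply/funext=> w.
- by rewrite wfD wfZ /wf_mul mulrDl scalerAl.
- by rewrite /wf_mul mulrA.
- exact: mul1r.
- rewrite wfB /wf_mul /wf_gen pbrMr mulrDr opprD addrACA addrK.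
  by case: w => [|j w]; rewrite ?mulr0 ?subr0 ?addr0 // mulrCA subrr addr0.
Qed.

Let word_module := word_eta.1.
Local Notation act := (env_act wf_mul (fp_eta wf_mul wf_gen)).

Lemma word_act_m a f w : act (m_ a) f w = a * f w.
Proof. by rewrite (env_act_m word_module). Qed.

Lemma word_act_gen i f w : act (h_ (x_ i)) f w = wf_gen i f w.
Proof. by rewrite (env_act_h word_module) word_eta.2. Qed.

Definition wf_delta (z : word) : wordfun n P := fun w => (w == z)%:R.

(* The coefficient of h_(x_i1) ... h_(x_il), for w = [:: i1; ...; il], in the
   expansion of u with left coefficients in P. *)
Definition ucoef (u : U) : wordfun n P := act u (wf_delta [::]).

Lemma ucoefD u v w : ucoef (u + v) w = ucoef u w + ucoef v w.
Proof. by rewrite /ucoef (env_actD word_module). Qed.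

Lemma ucoef1 w : ucoef 1 w = (w == [::])%:R.
Proof. by rewrite /ucoef -(rmorph1 (@env_m k P)) word_act_m mul1r. Qed.

Lemma ucoef_m a u w : ucoef (m_ a * u) w = a * ucoef u w.
Proof. by rewrite /ucoef (env_actM word_module) word_act_m. Qed.

Lemma ucoef_gen i u w : ucoef (h_ (x_ i) * u) w =
  \{x_ i, ucoef u w} + (if w is j :: w' then (j == i)%:R * ucoef u w' else 0).
Proof. by rewrite /ucoef (env_actM word_module) word_act_gen. Qed.

Lemma ucoef0 w : ucoef 0 w = 0.
Proof. by have := ucoef_m 0 0 w; rewrite mulr0 mul0r. Qed.

Lemma ucoefN u w : ucoef (- u) w = - ucoef u w.
Proof. by rewrite -mulN1r -(rmorphN1 (@env_m k P)) ucoef_m mulN1r. Qed.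

Lemma ucoefB u v w : ucoef (u - v) w = ucoef u w - ucoef v w.
Proof. by rewrite ucoefD ucoefN. Qed.

Lemma ucoefZ (c : k) u w : ucoef (c *: u) w = c *: ucoef u w.
Proof.
by rewrite -mulr_algl -(rmorph_alg (@env_m k P)) ucoef_m mulr_algl.
Qed.

Lemma ucoef_sum (I : Type) (r : seq I) (Q : pred I) (F : I -> U) w :
  ucoef (\sum_(i <- r | Q i) F i) w = \sum_(i <- r | Q i) ucoef (F i) w.
Proof.
by apply: (big_morph (fun u => ucoef u w)) => [u v|]; rewrite (ucoefD, ucoef0).
Qed.

(** Right multiplication by h_(x_i), read on coefficients; it commutes with the whole left action,
    which yields [ucoef_gen_r]. *)
Let rshift i (f : wordfun n P) : wordfun n P := fun w =>
  if w is j :: w' then (last j w' == i)%:R * f (belast j w') else 0.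

Let act_rshift u i f : act u (rshift i f) = rshift i (act u f).
Proof.
elim/envelope_gen_ind: u f => [a | l | u v IHu IHv | u v IHu IHv] f.
- apply/funext=> -[|j w]; rewrite word_act_m /= ?mulr0 //.
  by rewrite word_act_m mulrCA.
- apply/funext=> -[|j [|j' w]]; rewrite word_act_gen /wf_gen /=.
  + by rewrite pbr0 addr0.
  + by rewrite mulr0 !word_act_gen /wf_gen !addr0 !mulr_natl -!scaler_nat pbrZr.
  + rewrite word_act_gen /wf_gen mulrDr !mulr_natl -!scaler_nat pbrZr.
    by rewrite !scaler_nat -!mulrnA mulnC.
- rewrite !(env_actD word_module) IHu IHv; apply/funext=> -[|j w].
    by rewrite wfD addr0.
  by rewrite wfD /= wfD mulrDr.
- by rewrite !(env_actM word_module) IHv IHu.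
Qed.

Lemma ucoef_gen_r i u w : ucoef (u * h_ (x_ i)) w =
  if w is j :: w' then (last j w' == i)%:R * ucoef u (belast j w') else 0.
Proof.
rewrite /ucoef (env_actM word_module) -[RHS]/(rshift i (act u _) w) -act_rshift.
congr (act u _ _); apply/funext=> -[|j [|j' z]];
  rewrite word_act_gen /wf_gen /=.
- by rewrite pbr1 addr0.
- by rewrite pbr0 add0r.
- by rewrite pbr0 add0r !mulr0.
Qed.

Definition hword (w : word) : U := \prod_(i <- w) h_ (x_ i).

Lemma hword_cons i w : hword (i :: w) = h_ (x_ i) * hword w.
Proof. by rewrite /hword big_cons. Qed.

Lemma ucoef_hword w z : ucoef (hword w) z = (z == w)%:R.
Proof.
elim: w z => [|i w IH] z; first by rewrite /hword big_nil ucoef1.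
rewrite hword_cons ucoef_gen IH.
have -> : \{x_ i, ((z == w)%:R : P)} = 0 by case: (z == w); rewrite ?pbr1 ?pbr0.
by rewrite add0r; case: z => [//|j z]; rewrite IH -natrM mulnb eqseq_cons.
Qed.

Let expands (u : U) : exists s : seq (P * word),
  u = \sum_(p <- s) m_ p.1 * hword p.2.
Proof.
elim/envelope_left_ind: u => [|a u [s ->]|i u [s ->]|u v [s ->] [t ->]].
- exists [:: (1, [::])]; rewrite big_seq1 rmorph1 mul1r.
  by rewrite /hword big_nil.
- exists [seq (a * p.1, p.2) | p <- s]; rewrite big_map mulr_sumr.
  by apply: eq_bigr => p _; rewrite rmorphM mulrA.
- exists ([seq (\{x_ i, p.1}, p.2) | p <- s] ++
          [seq (p.1, i :: p.2) | p <- s]).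
  rewrite big_cat !big_map mulr_sumr /= -big_split; apply: eq_bigr => p _ /=.
  by rewrite hword_cons env_m_br mulrBl !mulrA subrK.
- by exists (s ++ t); rewrite big_cat.
Qed.

Definition dle (u : U) (e : nat) := forall w, (e < size w)%N -> ucoef u w = 0.

Lemma dle_exists u : exists e, dle u e.
Proof.
have [s ->] := expands u; exists (\max_(p <- s) size p.2) => w lt_sw.
rewrite ucoef_sum big_seq big1 // => p ps; rewrite ucoef_m ucoef_hword.
case: eqP => [wp|]; last by rewrite mulr0.
move: lt_sw; rewrite wp ltnNge => /negP[].
exact: (leq_bigmax_seq (F := fun p : P * word => size p.2)).
Qed.

(** An expansion may repeat words; grouping equal words shows that the coefficients of any expansion
    are those read off by [ucoef]. *)
Lemma ucoef_expand u e : dle u e -> exists2 s : seq word,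
  {in s, forall w, size w <= e}%N & u = \sum_(w <- s) m_ (ucoef u w) * hword w.
Proof.
move=> ue; have [s def_u] := expands u.
have cE w : ucoef u w = \sum_(p <- s | p.2 == w) p.1.
  rewrite {1}def_u ucoef_sum [RHS]big_mkcond; apply: eq_bigr => p _.
  by rewrite ucoef_m ucoef_hword eq_sym; case: eqP => _; rewrite ?mulr1 ?mulr0.
pose t := undup [seq p.2 | p <- s].
have uE : u = \sum_(w <- t) m_ (ucoef u w) * hword w.
  under eq_bigr => w _ do rewrite cE raddf_sum mulr_suml.
  rewrite {1}def_u (exchange_big_dep predT) //=; apply: eq_big_seq => p ps.
  have pt : p.2 \in t by rewrite mem_undup map_f.
  rewrite big_mkcond (bigD1_seq p.2) ?undup_uniq //= eqxx big1 ?addr0 //.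
  by move=> w; rewrite eq_sym => /negbTE ->.
exists [seq w <- t | size w <= e]%N => [w|]; first by rewrite mem_filter =>
  /andP[].
rewrite big_filter {1}uE [RHS]big_mkcond; apply: eq_bigr => w _.
by case: ltnP => // lt_ew; rewrite ue // rmorph0 mul0r.
Qed.

Lemma ucoef_inj u : (forall w, ucoef u w = 0) -> u = 0.
Proof.
move=> u0; have [s _ ->] := @ucoef_expand u 0 (fun w _ => u0 w).
by rewrite big1 // => w _; rewrite u0 rmorph0 mul0r.
Qed.

(** Moving letters past the coefficients of [v] creates bracket terms only at words of length below
    [size w + N], which the length conditions exclude. *)
Let ucoef_hwordM w v N z1 z2 : dle v N -> size z2 = N -> (size w <= size z1)%N
  ->
  ucoef (hword w * v) (z1 ++ z2) = (z1 == w)%:R * ucoef v z2.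
Proof.
move=> vN z2N; elim: w z1 => [|i w IH] z1 le_wz.
  rewrite /hword big_nil mul1r; case: z1 le_wz => [|j z1] _;
    first by rewrite mul1r.
  by rewrite mul0r vN // size_cat z2N ltnS leq_addl.
case: z1 le_wz => [//|j z1] le_wz; rewrite hword_cons -mulrA ucoef_gen IH;
  last exact: ltnW.
have /negbTE-> : j :: z1 != w by apply: contraTneq le_wz => <- /=; rewrite ltnn.
by rewrite mul0r pbr0 add0r /= IH // mulrA -natrM mulnb eqseq_cons.
Qed.

(** At this length only top terms contribute, so leading coefficients multiply as in a free
    associative algebra over the commutative ring P. *)
Lemma ucoefM u v e N z1 z2 : dle u e -> dle v N ->
  (e <= size z1)%N -> size z2 = N -> ucoef (u * v) (z1 ++ z2) = ucoef u z1 *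
    ucoef v z2.
Proof.
move=> ue vN le_ez z2N; have [s sP uE] := ucoef_expand ue.
rewrite uE mulr_suml !ucoef_sum mulr_suml; apply: eq_big_seq => w ws.
rewrite -mulrA !ucoef_m (ucoef_hwordM vN) ?(leq_trans (sP w ws)) //.
by rewrite ucoef_hword mulrA.
Qed.

Lemma dleM u v e N : dle u e -> dle v N -> dle (u * v) (e + N).
Proof.
move=> ue vN w lt_w.
suff: ucoef (u * v) (take (size w - N) w ++ drop (size w - N) w) = 0.
  by rewrite cat_take_drop.
have le_Nw : (N <= size w)%N by apply: leq_trans (ltnW lt_w); apply: leq_addl.
rewrite (ucoefM ue vN) ?size_drop ?size_takel ?leq_subr ?subKn //; last first.
  by rewrite leq_subRL // addnC ltnW.
by rewrite ue ?mul0r // size_takel ?leq_subr // ltn_subRL addnC.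
Qed.

Lemma dle_leq u e e' : (e <= e')%N -> dle u e -> dle u e'.
Proof. by move=> le_e ue w lt_w; apply: ue; apply: leq_ltn_trans lt_w. Qed.

Lemma dle_lead u :
  u = 0 \/ exists e z, [/\ dle u e, size z = e & ucoef u z != 0].
Proof.
have [e] := dle_exists u; elim: e => [|e IH] ue.
  have [u0|u0] := eqVneq (ucoef u [::]) 0; last by right; exists 0, [::].
  by left; apply: ucoef_inj => -[//|i w]; apply: ue.
case: (pselect (exists2 z, size z = e.+1 & ucoef u z != 0)) => [[z ze uz]|H].
  by right; exists e.+1, z.
apply: IH => w; rewrite leq_eqVlt => /predU1P[ew|/ue//].
by apply/eqP; apply: contra_notT H => uw; exists w.
Qed.

End Coefficients.

(** * Partial derivatives of the free Poisson algebra *)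

Section PartialDerivatives.
Variables (k : fieldType) (n : nat).
Local Notation P := (freePoisson k n).
Local Notation U := (envelope P).
Local Notation word := (seq 'I_n).
Local Notation x_ i := (fp_gen i : P).

Definition lieword (w : word) (i : 'I_n) : P :=
  foldr (fun j a => \{x_ j, a}) (x_ i) w.

Section LiewordInduction.
Variable S : P -> Prop.
Hypotheses (Sl : forall w i, S (lieword w i)) (Sc : forall c : k, S c%:A).
Hypotheses (SD : forall a b, S a -> S b -> S (a + b))
  (SM : forall a b, S a -> S b -> S (a * b)).

Inductive lie_span : P -> Prop :=
  | lie_span_word w i : lie_span (lieword w i)
  | lie_spanN a : lie_span a -> lie_span (- a)
  | lie_spanD a b : lie_span a -> lie_span b -> lie_span (a + b).

Inductive lie_alg : P -> Prop :=
  | lie_alg_span a : lie_span a -> lie_alg a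
  | lie_alg_const (c : k) : lie_alg c%:A
  | lie_algD a b : lie_alg a -> lie_alg b -> lie_alg (a + b)
  | lie_algM a b : lie_alg a -> lie_alg b -> lie_alg (a * b).

Let lie_span_gen i a : lie_span a -> lie_span \{x_ i, a}.
Proof.
elim=> [w j | b _ IH | b c _ IHb _ IHc].
- exact: (lie_span_word (i :: w)).
- by rewrite -scaleN1r pbrZr scaleN1r; apply: lie_spanN.
- by rewrite pbrDr; apply: lie_spanD.
Qed.

(** By the Jacobi identity, bracketing with {x_j, a} is the commutator of bracketing with x_j and
    with a; this reduces to brackets with one generator. *)
Let lie_span_br a b : lie_span a -> lie_span b -> lie_span \{a, b}.
Proof.
move=> Sa Sb; elim: Sa b Sb => {a} [w i | a _ IH | a c _ IHa _ IHc] b Sb.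
- elim: w b Sb => [|j w IH] b Sb /=; first exact: lie_span_gen.
  rewrite pbr_der; apply: lie_spanD; first exact/lie_span_gen/IH.
  exact/lie_spanN/IH/lie_span_gen.
- by rewrite -scaleN1r pbrZl scaleN1r; apply/lie_spanN/IH.
- by rewrite pbrDl; apply: lie_spanD; [apply: IHa | apply: IHc].
Qed.

Let lie_alg_br a b : lie_alg a -> lie_alg b -> lie_alg \{a, b}.
Proof.
have const_br (c : k) d : \{c%:A, d} = 0 :> P by rewrite pbrC pbr_scalar oppr0.
move=> Sa; elim: Sa b => {a} [a Sa | c | a c _ IHa _ IHc | a c Sa IHa Sc' IHc]
  b Sb.
- elim: Sb => {b} [b Sb | c | b c _ IHb _ IHc | b c Sb IHb Sc' IHc].
  + exact/lie_alg_span/lie_span_br.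
  + by rewrite pbr_scalar -(scale0r 1); apply: lie_alg_const.
  + by rewrite pbrDr; apply: lie_algD.
  + by rewrite pbrMr; apply: lie_algD; apply: lie_algM.
- by rewrite const_br -(scale0r 1); apply: lie_alg_const.
- by rewrite pbrDl; apply: lie_algD; [apply: IHa | apply: IHc].
- by rewrite pbrMl; apply: lie_algD; apply: lie_algM => //;
  [apply: IHc | apply: IHa].
Qed.

(** Polynomials in the right-normed brackets are closed under the bracket, by the Jacobi and Leibniz
    identities, and so exhaust P. *)
Lemma freePoisson_lieword_ind a : S a.
Proof.
suff: lie_alg a.
  elim=> {a} [a | c | a b _ Sa _ Sb | a b _ Sa _ Sb];
    [ | exact: Sc | exact: SD | exact: SM].
  elim=> {a} [w i | a _ Sa | a b _ Sa _ Sb]; [exact: Sl | | exact: SD].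
  by rewrite -mulN1r -scaleN1r; apply: SM.
elim/freePoisson_ind: a => [i | c | a b | a b | a b].
- exact: (lie_alg_span (lie_span_word [::] i)).
- exact: lie_alg_const.
- exact: lie_algD.
- exact: lie_algM.
- exact: lie_alg_br.
Qed.

End LiewordInduction.

(* On the polynomial algebra P = Sym(L), the partial derivative in the
   direction of the linear form on the free Lie algebra L that reads off the
   coefficient of the word w. *)
Definition wderiv (w : word) (a : P) : P := ucoef (env_h a) w.

Fact wderiv_is_linear w : linear (wderiv w).
Proof. by move=> c a b; rewrite /wderiv linearP ucoefD ucoefZ. Qed.
HB.instance Definition _ w :=
  GRing.isLinear.Build k P P *:%R (wderiv w) (wderiv_is_linear w).

Lemma wderivM w a b : wderiv w (a * b) = a * wderiv w b + b * wderiv w a.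
Proof. by rewrite /wderiv env_hM ucoefD !ucoef_m addrC. Qed.

Lemma wderiv_gen w i : wderiv w (x_ i) = (w == [:: i])%:R.
Proof. by rewrite /wderiv -(ucoef_hword k [:: i]) /hword big_seq1. Qed.

Lemma wderiv_const w (c : k) : wderiv w c%:A = 0.
Proof. by rewrite /wderiv linearZ /= env_h1 scaler0 ucoef0. Qed.

Lemma wderiv_nil a : wderiv [::] a = 0.
Proof.
rewrite /wderiv (foxP a) ucoef_sum big1 // => i _; exact: ucoef_gen_r.
Qed.

(** The differential of a Lie word is an iterated commutator of letters, hence homogeneous; its
    coefficients stay constant because brackets with constants vanish. *)
Lemma wderiv_lieword z w i : (exists c : k, wderiv z (lieword w i) = c%:A) /\
  (size z != (size w).+1 -> wderiv z (lieword w i) = 0).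
Proof.
elim: w z => [|j w IH] z /=.
  rewrite wderiv_gen; split; last by case: (z =P [:: i]) => [->|].
  by exists (z == [:: i])%:R; rewrite scaler_nat.
have [[c zc] z0] := IH z.
rewrite /wderiv env_h_br ucoefB ucoef_gen ucoef_gen_r -/(wderiv _ _) zc
  pbr_scalar add0r.
case: z {z0 zc} => [|l z].
  by rewrite subrr; split=> //; exists 0; rewrite scale0r.
have [[c1 c1E] z1] := IH z; have [[c2 c2E] z2] := IH (belast l z).
rewrite -!/(wderiv _ _) /= eqSS; split.
  exists ((l == j)%:R * c1 - (last l z == j)%:R * c2).
  rewrite c1E c2E scalerBl -!scalerA.
  by rewrite !mulr_natl -!scaler_nat.
by move=> zw; rewrite z1 // z2 ?size_belast // !mulr0 subrr.
Qed.

(* The commutator of two partial derivatives is a derivation killing the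
   brackets of the generators. *)
Lemma wderivC u v a : wderiv u (wderiv v a) = wderiv v (wderiv u a).
Proof.
elim/freePoisson_lieword_ind: a => [w i | c | a b IHa IHb | a b IHa IHb].
- have [[[c ->] _] [[d ->] _]] := (wderiv_lieword u w i, wderiv_lieword v w i).
  by rewrite !wderiv_const.
- by rewrite !wderiv_const !raddf0.
- by rewrite !raddfD /= IHa IHb.
- rewrite !wderivM !raddfD /= !wderivM IHa IHb !addrA.
  by rewrite [LHS](ACl (1*4*3*2))/= (mulrC (wderiv v b)) (mulrC (wderiv v a)).
Qed.

(** A substitute for polynomial degree below [m] in Sym(L) that avoids a basis of L; later
    inductions run on [m]. *)
Fixpoint wnil (m : nat) (a : P) : Prop :=
  if m is m'.+1 then forall w, wnil m' (wderiv w a) else a = 0.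

Lemma wnil0 m : wnil m 0.
Proof. by elim: m => //= m IH w; rewrite raddf0. Qed.

Lemma wnilS m a : wnil m a -> wnil m.+1 a.
Proof.
elim: m a => [a -> w | m IH a am w]; first exact: raddf0.
exact/IH/am.
Qed.

Lemma wnil_leq m m' a : (m <= m')%N -> wnil m a -> wnil m' a.
Proof. by move=> /subnK <-; elim: (m' - m)%N => // d IH /IH /wnilS. Qed.

Lemma wnilD m a b : wnil m a -> wnil m b -> wnil m (a + b).
Proof.
elim: m a b => [a b -> -> | m IH a b am bm w]; first exact: addr0.
by rewrite raddfD; apply: IH; [apply: am | apply: bm].
Qed.

Lemma wnilM m m' a b : wnil m a -> wnil m' b -> wnil (m + m') (a * b).
Proof.
move: {2}(m + m')%N (erefl (m + m')%N) => s.
elim: s m m' a b => [|s IH] [|m] [|m'] a b //= sE am bm'.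
- by rewrite am mul0r.
- by rewrite am mul0r => w; rewrite raddf0; apply: wnil0.
- by rewrite bm' mulr0 => w; rewrite raddf0; apply: wnil0.
move=> w; rewrite wderivM addnS; case: sE; rewrite addnS => sE.
apply: wnilD; first by apply: (IH m.+1 m' a (wderiv w b)); rewrite ?addSn.
by rewrite (mulrC b) -addnS; apply: (IH m m'.+1 (wderiv w a) b); rewrite ?addnS.
Qed.

Lemma wnil_exists a : exists m, wnil m a.
Proof.
elim/freePoisson_lieword_ind: a => [w i|c|a b [m am] [m' bm]|a b [m am] [m'
  bm]].
- exists 2%N => u v; have [[c ->] _] := wderiv_lieword u w i.
  exact: wderiv_const.
- by exists 1%N => w; apply: wderiv_const.
- exists (m + m')%N; apply: wnilD.
    apply: wnil_leq am; apply: leq_addr.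
  apply: wnil_leq bm; apply: leq_addl.
- by exists (m + m')%N; apply: wnilM.
Qed.

Section FoxCalculus.
Variable j : 'I_n.

Let foxE (a : P) (u : 'I_n -> U) :
  env_h a = \sum_(i < n) u i * env_h (x_ i) -> fox a j = u j.
Proof. by rewrite (foxP a) => /fox_unique. Qed.

Lemma foxD (a b : P) : fox (a + b) j = fox a j + fox b j.
Proof.
apply: (foxE (u := fun i => fox a i + fox b i)).
rewrite raddfD /= (foxP a) (foxP b) -big_split; apply: eq_bigr => i _.
by rewrite mulrDl.
Qed.

Lemma fox_const (c : k) : fox (c%:A : P) j = 0.
Proof.
apply: (foxE (u := fun=> 0)); rewrite linearZ /= env_h1 scaler0 big1 // => i _.
exact: mul0r.
Qed.

Lemma fox_gen i : fox (x_ i) j = (i == j)%:R.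
Proof.
apply: (foxE (u := fun l => (i == l)%:R)); rewrite (bigD1 i) //= eqxx mul1r.
by rewrite big1 ?addr0 // => l /negbTE li; rewrite eq_sym li mul0r.
Qed.

Lemma foxM (a b : P) : fox (a * b) j = env_m b * fox a j + env_m a * fox b j.
Proof.
apply: (foxE (u := fun i => env_m b * fox a i + env_m a * fox b i)).
rewrite env_hM {1}(foxP a) {1}(foxP b) !mulr_sumr -big_split;
  apply: eq_bigr => i _ /=.
by rewrite mulrDl !mulrA.
Qed.

Lemma fox_br (a b : P) : fox \{a, b} j = env_h a * fox b j - env_h b * fox a j.
Proof.
apply: (foxE (u := fun i => env_h a * fox b i - env_h b * fox a i)).
rewrite env_h_br {2}(foxP a) {1}(foxP b) !mulr_sumr -sumrB;
  apply: eq_bigr => i _ /=.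
by rewrite mulrBl !mulrA.
Qed.

End FoxCalculus.

Local Notation ract := (env_act (fun a b : P => a * b) (fun a b : P => \{a,
  b})).
Let ractM := env_actM (regular_module P).
Let ractD := env_actD (regular_module P).

Let ract0 b : ract 0 b = 0.
Proof. by have := env_act_const (regular_module P) 0 b; rewrite !scale0r. Qed.

Let ract_sub u v b : ract (u - v) b = ract u b - ract v b.
Proof.
rewrite ractD; congr (_ + _); apply/eqP.
by rewrite -addr_eq0 -ractD addNr ract0.
Qed.

(* The derivation of the Poisson algebra P that multiplies an element of total
   degree d in the generators by d. *)
Definition euler (a : P) : P := \sum_(j < n) ract (fox a j) (x_ j).

Lemma eulerD a b : euler (a + b) = euler a + euler b.
Proof. by rewrite -big_split; apply: eq_bigr => j _; rewrite foxD ractD. Qed.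

Lemma euler_const (c : k) : euler c%:A = 0.
Proof. by rewrite /euler big1 // => j _; rewrite fox_const ract0. Qed.

Lemma euler_gen i : euler (x_ i) = x_ i.
Proof.
rewrite /euler (bigD1 i) //= fox_gen eqxx big1 ?addr0 => [|j /negbTE ji].
  by rewrite -(rmorph1 (@env_m k P)) (env_act_m (regular_module P)) mul1r.
by rewrite fox_gen eq_sym ji ract0.
Qed.

Lemma eulerM a b : euler (a * b) = a * euler b + b * euler a.
Proof.
rewrite /euler !mulr_sumr -big_split; apply: eq_bigr => j _ /=.
by rewrite foxM ractD !ractM !(env_act_m (regular_module P)) addrC.
Qed.

Lemma euler_br a b : euler \{a, b} = \{a, euler b} - \{b, euler a}.
Proof.
have pbr_sum c (F : 'I_n -> P) : \{c, \sum_j F j} = \sum_j \{c, F j}.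
  by apply: (big_morph (@pbr k P c)) => [d e|]; rewrite (pbrDr, pbr0).
rewrite /euler !pbr_sum -sumrB; apply: eq_bigr => j _ /=.
by rewrite fox_br ract_sub !ractM !(env_act_h (regular_module P)).
Qed.

Lemma eulerZ (c : k) a : euler (c *: a) = c *: euler a.
Proof. by rewrite -mulr_algl eulerM euler_const mulr0 addr0 mulr_algl. Qed.

Lemma euler_lieword w i : euler (lieword w i) = (size w).+1%:R *: lieword w i.
Proof.
elim: w => [|j w IH] /=; first by rewrite euler_gen scale1r.
rewrite euler_br IH euler_gen pbrZr (pbrC (lieword w i)) opprK.
by rewrite -{2}(scale1r \{_, _}) -scalerDl natr1.
Qed.

Let eigenvectors (s : seq (nat * P)) := {in s, forall p,
  euler p.2 = p.1%:R *: p.2 /\ (p.1 = 0%N -> exists c : k, p.2 = c%:A)}.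

(** A product of Lie words is an eigenvector of [euler], with its total number of letters as
    eigenvalue. *)
Let eigen_decomposition a :
  exists2 s, eigenvectors s & a = \sum_(p <- s) p.2.
Proof.
elim/freePoisson_lieword_ind: a => [w i|c|a b [s sP ->] [t tP ->]|a b [s sP ->]
  [t tP ->]].
- exists [:: ((size w).+1, lieword w i)]; last by rewrite big_seq1.
  by move=> p; rewrite inE => /eqP->; rewrite euler_lieword.
- exists [:: (0%N, c%:A)]; last by rewrite big_seq1.
  move=> p; rewrite inE => /eqP-> /=; rewrite euler_const scale0r; split=> // _.
  by exists c.
- exists (s ++ t); last by rewrite big_cat.
  by move=> p; rewrite mem_cat => /orP[/sP|/tP].
- exists [seq ((p.1 + q.1)%N, p.2 * q.2) | p <- s, q <- t]; last first.
    rewrite big_allpairs_dep mulr_suml; apply: eq_bigr => p _.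
    by rewrite mulr_sumr.
  move=> _ /allpairsP[[p q] /= [/sP[pE p0] /tP[qE q0] ->]] /=; split.
    rewrite eulerM pE qE -scalerAr -scalerAr (mulrC q.2) -scalerDl.
    by rewrite natrD addrC.
  move=> /eqP; rewrite addn_eq0 => /andP[/eqP/p0[c ->] /eqP/q0[d ->]].
  by exists (c * d); rewrite -scalerAl mul1r scalerA.
Qed.

Hypothesis char0 : [pchar k] =i pred0.

Lemma euler_eq0 a : euler a = 0 -> exists c : k, a = c%:A.
Proof.
have natk m : (m.+1%:R : k) != 0 by rewrite ((pcharf0P k).1 char0).
have [s sP ->] := eigen_decomposition a.
have [M] : exists M, {in s, forall p, p.1 <= M}%N.
  exists (\max_(p <- s) p.1) => p ps.
  exact: (leq_bigmax_seq (F := fun p : nat * P => p.1)).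
elim: M s sP {a} => [|M IH] s sP sM.
  move=> _; elim: s sP sM => [|p s IHs] sP sM.
    by exists 0; rewrite big_nil scale0r.
  rewrite big_cons; have [|//|c ->] := IHs.
    - by move=> q qs; apply: sP; rewrite inE qs orbT.
    - by move=> q qs; apply: sM; rewrite inE qs orbT.
  have ps : p \in p :: s by rewrite inE eqxx.
  have [_ p0] := sP p ps; have /p0[d ->] : p.1 = 0%N by apply/eqP;
    rewrite -leqn0 sM.
  by exists (d + c); rewrite scalerDl.
set a := \sum_(p <- s) p.2 => a0.
(* Applying [euler] minus [M.+1] kills the components of degree [M.+1]; as [euler a = 0], the result
   is a nonzero multiple of [a], now with degrees at most [M]. *)
pose t := [seq (p.1, (p.1%:R - M.+1%:R : k) *: p.2) | p <- s & (p.1 <= M)%N].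
have tE : \sum_(p <- t) p.2 = - M.+1%:R *: a.
  transitivity (euler a - M.+1%:R *: a); last by rewrite a0 sub0r scaleNr.
  have -> : euler a = \sum_(p <- s) euler p.2.
    apply: (big_morph euler) => [b c|]; first exact: eulerD.
    by have := euler_const 0; rewrite scale0r.
  rewrite scaler_sumr -sumrB big_map big_filter big_mkcond /=.
  apply: eq_big_seq => p ps; have [-> _] := sP p ps; rewrite -scalerBl.
  by case: ifPn => // pM; have /eqP-> : p.1 == M.+1;
    rewrite ?subrr ?scale0r // eqn_leq sM //= ltnNge.
have [|||c] := IH t.
- move=> q /mapP[p]; rewrite mem_filter => /andP[_ /sP[pE p0]] -> /=; split.
    by rewrite eulerZ pE !scalerA mulrC.
  move=> /p0[c ->]; eexists; exact: scalerA.
- by move=> q /mapP[p]; rewrite mem_filter => /andP[pM _] -> /=.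
- by rewrite tE eulerZ a0 scaler0.
rewrite tE => /(congr1 ( *:%R (- M.+1%:R)^-1));
  rewrite !scalerA mulVf ?oppr_eq0 //.
by rewrite scale1r => ->; eexists.
Qed.

(** If h_a = 0, all Fox derivatives of [a] vanish, hence so does [euler a]. *)
Lemma wderiv_eq0 a : (forall w, wderiv w a = 0) -> exists c : k, a = c%:A.
Proof.
move=> /ucoef_inj ha0; apply: euler_eq0; rewrite /euler big1 // => j _.
suff -> : fox a j = 0 by apply: ract0.
apply: (@fox_unique k n (fox a) (fun=> 0)); rewrite -foxP ha0 big1 // => i _.
by rewrite mul0r.
Qed.

End PartialDerivatives.

(** * The free Poisson algebra is an integral domain *)

Section IntegralDomain.
Variables (k : fieldType) (n : nat).
Local Notation P := (freePoisson k n).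
Hypothesis char0 : [pchar k] =i pred0.

Lemma wderivXn w (a : P) m :
  wderiv w (a ^+ m) = m%:R *: (a ^+ m.-1 * wderiv w a).
Proof.
elim: m => [|m IH]; first by rewrite scale0r -[a ^+ 0]scale1r wderiv_const.
rewrite exprS wderivM IH -scalerAr mulrA.
case: m {IH} => [|m] /=; first by rewrite scale0r add0r scale1r.
by rewrite -exprS -[X in _ + X]scale1r -scalerDl natr1.
Qed.

(* Applied m times to a ^+ m = 0, this shows that wderiv w a is nilpotent. *)
Let wderiv_step w (a : P) r s : a ^+ r.+1 * wderiv w a ^+ s = 0 ->
  a ^+ r * wderiv w a ^+ s.+2 = 0.
Proof.
set d := wderiv w a => ad; apply/eqP.
have : (r.+1%:R : k) *: (a ^+ r * d ^+ s.+2) = 0.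
  have := congr1 (fun b => wderiv w b * d) ad.
  rewrite raddf0 mul0r wderivM !wderivXn mulrDl -/d -!scalerAr -!scalerAl.
  have -> : (s%:R : k) *: (a ^+ r.+1 * (d ^+ s.-1 * wderiv w d) * d) = 0.
    case: s ad => [|s] ad; first by rewrite scale0r.
    have -> : a ^+ r.+1 * (d ^+ s * wderiv w d) * d =
      a ^+ r.+1 * d ^+ s.+1 * wderiv w d by rewrite !exprS; ring.
    by rewrite ad mul0r scaler0.
  by rewrite add0r => <-; congr (_ *: _); rewrite !exprS; ring.
by move=> /eqP; rewrite scaler_eq0 ((pcharf0P k).1 char0).
Qed.

(** Derivatives of a nilpotent element are nilpotent, hence zero by induction on the degree, and [a]
    is a nilpotent constant. *)
Lemma freePoisson_reduced (a : P) m : a ^+ m = 0 -> a = 0.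
Proof.
have [s] := wnil_exists a; elim: s a m => [//|s IH] a m am a0.
have [w | c def_a] := wderiv_eq0 char0 (a := a); last first.
  move/eqP: a0; rewrite def_a exprZn expr1n scaler_eq0 oner_eq0 orbF expf_eq0.
  by case/andP=> _ /eqP->; rewrite scale0r.
set d := wderiv w a; apply: (IH d (m.*2)); first exact: am.
(* Each step trades one factor [a] for two factors [d], until no [a] is left. *)
suff step r : (r <= m)%N -> a ^+ (m - r) * d ^+ r.*2 = 0.
  by have := step m (leqnn m); rewrite subnn mul1r.
elim: r => [|r IHr] lt_rm; first by rewrite subn0 a0 mul0r.
rewrite doubleS; apply: wderiv_step.
by rewrite -subSn // subSS IHr // ltnW.
Qed.

(** Differentiating [a * b = 0] and multiplying by [a] gives [a ^+ 2 * wderiv w b = 0], in which [b]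
    is replaced by an element of smaller degree. *)
Lemma freePoisson_domain (a b : P) : a * b = 0 -> a = 0 \/ b = 0.
Proof.
have [s] := wnil_exists b; elim: s a b => [|s IH] a b bs ab; first by right.
have [b0 | b_neq0] := eqVneq b 0; [by right | left].
case: (pselect (exists w, wderiv w b != 0)) => [[w db] | H]; last first.
  have [w | c def_b] := wderiv_eq0 char0 (a := b).
    by apply/eqP; apply: contra_notT H => ?; exists w.
  move: ab b_neq0; rewrite def_b mulr_algr => /eqP.
  by rewrite scaler_eq0 => /orP[/eqP-> | /eqP//]; rewrite scale0r eqxx.
have aadb : (a ^+ 2) * wderiv w b = 0.
  have := congr1 (fun c => a * wderiv w c) ab.
  by rewrite raddf0 mulr0 wderivM mulrDr !mulrA ab mul0r addr0.
have [a2 | /eqP] := IH _ _ (bs w) aadb; last by rewrite (negbTE db).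
exact: freePoisson_reduced a2.
Qed.

End IntegralDomain.

(** * Abelianization onto the polynomial algebra *)

Section ZeroBracket.
Variables (k : fieldType) (n : nat).
Local Notation A := {mpoly k[n]}.

(** The zero bracket makes k[x_1, ..., x_n] a Poisson algebra, so that the universal property
    provides the abelianization [fp_ab]. *)
Definition mpoly_br (p q : A) : A := 0.

Fact mpoly_brDl (a b c : A) : mpoly_br (a + b) c = mpoly_br a c + mpoly_br b c.
Proof. by rewrite addr0. Qed.
Fact mpoly_brDr (a b c : A) : mpoly_br a (b + c) = mpoly_br a b + mpoly_br a c.
Proof. by rewrite addr0. Qed.
Fact mpoly_brZl (t : k) (a b : A) : mpoly_br (t *: a) b = t *: mpoly_br a b.
Proof. by rewrite scaler0. Qed.
Fact mpoly_brZr (t : k) (a b : A) : mpoly_br a (t *: b) = t *: mpoly_br a b.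
Proof. by rewrite scaler0. Qed.
Fact mpoly_brxx (a : A) : mpoly_br a a = 0.
Proof. by []. Qed.
Fact mpoly_jacobi (a b c : A) :
  mpoly_br a (mpoly_br b c) + mpoly_br b (mpoly_br c a) + mpoly_br c (mpoly_br
    a b) = 0.
Proof. by rewrite !addr0. Qed.
Fact mpoly_brMr (a b c : A) :
  mpoly_br a (b * c) = mpoly_br a b * c + b * mpoly_br a c.
Proof. by rewrite mul0r mulr0 addr0. Qed.

HB.instance Definition _ := isPoisson.Build k A
  mpoly_brDl mpoly_brDr mpoly_brZl mpoly_brZr mpoly_brxx mpoly_jacobi
    mpoly_brMr.

Lemma mpoly_gen_ind (S : A -> Prop) :
  (forall i, S 'X_i) -> (forall c : k, S c%:A) ->
  (forall p q, S p -> S q -> S (p + q)) ->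
  (forall p q, S p -> S q -> S (p * q)) -> forall p, S p.
Proof.
move=> SX Sc SD SM; elim/mpolyind => [|c m p _ _ Sp].
  by rewrite -(scale0r 1); apply: (Sc).
apply: (SD) => //; rewrite -mulr_algl; apply: (SM); first exact: (Sc).
rewrite mpolyXE_id; have S1 : S 1 by rewrite -(scale1r 1); apply: (Sc).
apply: (big_ind S) => [||i _]; [exact: S1 | exact: (SM) | ].
elim: (m i) => [|d IH]; first by rewrite expr0.
by rewrite exprS; apply: (SM).
Qed.

Lemma mderiv_gen i j : ('X_j : A)^`M(i) = (i == j)%:R.
Proof.
rewrite mderivX mnm1E eq_sym; case: eqP => [->|_]; last exact: scale0r.
by rewrite -{1}[U_(j)%MM]add0m addmK mpolyX0 scale1r.
Qed.

End ZeroBracket.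

Section Abelianization.
Variables (k : fieldType) (n : nat).
Local Notation P := (freePoisson k n).
Local Notation A := {mpoly k[n]}.
Local Notation x_ i := (fp_gen i : P).

Definition fp_ab : P -> A := fp_lift (fun i => 'X_i : A).
HB.instance Definition _ := PoissonMorphism.on fp_ab.

Definition fp_poly : A -> P := mmap (GRing.in_alg P) (@fp_gen k n).
HB.instance Definition _ := GRing.RMorphism.on fp_poly.

Fact fp_poly_scalable : scalable fp_poly.
Proof. by move=> c p; rewrite /fp_poly mmapZ mulr_algl. Qed.
HB.instance Definition _ := GRing.isScalable.Build k A P *:%R fp_poly
  fp_poly_scalable.

Lemma fp_poly_gen i : fp_poly 'X_i = x_ i.
Proof. by rewrite /fp_poly mmapX mmap1U. Qed.

Lemma fp_ab_gen i : fp_ab (x_ i) = 'X_i.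
Proof. exact: fp_lift_gen. Qed.

Lemma fp_ab_br a b : fp_ab \{a, b} = 0.
Proof. by rewrite /fp_ab pbr_morph. Qed.

Lemma fp_polyK : cancel fp_poly fp_ab.
Proof.
elim/mpoly_gen_ind => [i | c | p q IHp IHq | p q IHp IHq].
- by rewrite fp_poly_gen fp_ab_gen.
- by rewrite !rmorph_alg.
- by rewrite !rmorphD /= IHp IHq.
- by rewrite !rmorphM /= IHp IHq.
Qed.

Lemma env_h_poly p :
  env_h (fp_poly p) = \sum_(i < n) env_m (fp_poly p^`M(i)) * env_h (x_ i).
Proof.
elim/mpoly_gen_ind: p => [i | c | p q IHp IHq | p q IHp IHq].
- rewrite fp_poly_gen (bigD1 i) //= big1 => [|j /negbTE ji].
    by rewrite mderiv_gen eqxx !rmorph1 mul1r addr0.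
  by rewrite mderiv_gen ji !rmorph0 mul0r.
- rewrite rmorph_alg linearZ /= env_h1 scaler0 big1 // => i _.
  by rewrite alg_mpolyC mderivC !rmorph0 mul0r.
- rewrite rmorphD raddfD /= IHp IHq -big_split; apply: eq_bigr => i _ /=.
  by rewrite mderivD !rmorphD mulrDl.
- rewrite rmorphM env_hM IHp IHq !mulr_sumr -big_split;
  apply: eq_bigr => i _ /=.
  rewrite mderivM !rmorphD !rmorphM /= mulrDl !mulrA -!rmorphM /=.
  by rewrite (mulrC q).
Qed.

Lemma wderiv_poly w p : wderiv w (fp_poly p) =
  if w is [:: i] then fp_poly p^`M(i) else 0.
Proof.
rewrite /wderiv env_h_poly ucoef_sum.
have E i : ucoef (env_m (fp_poly p^`M(i)) * env_h (x_ i)) w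
    = fp_poly p^`M(i) * (w == [:: i])%:R.
  by rewrite ucoef_m -(ucoef_hword k [:: i]) /hword big_seq1.
under eq_bigr => i _ do rewrite E.
case: w {E} => [|j [|l w]]; try by rewrite big1 // => i _; rewrite mulr0.
  rewrite (bigD1 j) //= eqxx mulr1 big1 ?addr0 // => i /negbTE ij.
  by rewrite eqseq_cons eq_sym ij mulr0.
by rewrite big1 // => i _; rewrite eqseq_cons andbF mulr0.
Qed.

Lemma fp_ab_wderiv i a : fp_ab (wderiv [:: i] a) = (fp_ab a)^`M(i).
Proof.
elim/freePoisson_lieword_ind: a => [w j | c | a b IHa IHb | a b IHa IHb].
- case: w => [|l w] /=.
    by rewrite wderiv_gen fp_ab_gen mderiv_gen eqseq_cons andbT rmorph_nat.
  rewrite fp_ab_br mderiv0.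
  have [_ /(_ isT)] := wderiv_lieword k [:: i] (l :: w) j.
  by move=> /= ->; rewrite rmorph0.
- by rewrite wderiv_const rmorph_alg alg_mpolyC mderivC rmorph0.
- by rewrite raddfD !rmorphD /= mderivD IHa IHb.
- rewrite wderivM rmorphM !rmorphD /= !rmorphM /= IHa IHb mderivM addrC.
  by rewrite (mulrC (fp_ab b)).
Qed.

Hypothesis char0 : [pchar k] =i pred0.

(** Derivatives along single letters inherit both hypotheses, so by induction they vanish and [a] is
    constant. *)
Let fp_ab_eq0 (a : P) : (forall w, (1 < size w)%N -> wderiv w a = 0) ->
  fp_ab a = 0 -> a = 0.
Proof.
have [m] := wnil_exists a; elim: m a => [//|m IH] a am a1 a0.
have [w | c def_a] := wderiv_eq0 char0 (a := a).
  case: w => [|i [|j w]]; [exact: wderiv_nil | | exact: a1].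
  apply: IH; [exact: am | | by rewrite fp_ab_wderiv a0 mderiv0].
  by move=> w w1; rewrite wderivC a1 ?raddf0.
move: a0; rewrite def_a rmorph_alg => /eqP.
by rewrite scaler_eq0 oner_eq0 orbF => /eqP->; rewrite scale0r.
Qed.

Lemma wderiv_polyP (a : P) : (forall w, (1 < size w)%N -> wderiv w a = 0) ->
  fp_poly (fp_ab a) = a.
Proof.
move=> a1; apply/eqP; rewrite -subr_eq0; apply/eqP/fp_ab_eq0 => [w w1|].
  by rewrite raddfB /= a1 // wderiv_poly subr0; case: w w1 => [|i []].
by rewrite rmorphB /= fp_polyK subrr.
Qed.

End Abelianization.

(** * The shuffle algebra and Lie elements *)

Section ShuffleRing.
Variables (n : nat) (R : comPzRingType).
Local Notation word := (seq 'I_n).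
Local Notation W := (wordfun n R).
Implicit Types (f g h : W) (w z t : word).

Definition strip (i : 'I_n) (f : W) : W := fun w => f (i :: w).

(** The value at [w] is the sum of f(w') g(w'') over all splittings of [w] into complementary
    subwords; in this form each [strip i] is a derivation by definition. *)
Fixpoint shuffle_mul (f g : W) (w : word) : R :=
  if w is i :: w' then shuffle_mul (strip i f) g w' + shuffle_mul f (strip i g)
    w'
  else f [::] * g [::].

Definition shuffle_one : W := fun w => (w == [::])%:R.

Fact shuffle_mulC : commutative (shuffle_mul : W -> W -> W).
Proof.
move=> f g; apply/funext=> w; elim: w f g => [|i w IH] f g /=;
  first exact: mulrC.
by rewrite IH (IH f) addrC.
Qed.

Fact shuffle_mulDl : left_distributive (shuffle_mul : W -> W -> W) +%R.
Proof.
move=> f g h; apply/funext=> w; elim: w f g h => [|i w IH] f g h.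
  exact: mulrDl.
by rewrite wfD /= -[strip i (f + g)]/(strip i f + strip i g) !IH !wfD addrACA.
Qed.

Fact shuffle_mulA : associative (shuffle_mul : W -> W -> W).
Proof.
move=> f g h; apply/funext=> w; elim: w f g h => [|i w IH] f g h.
  exact: mulrA.
rewrite /= -[strip i (shuffle_mul f g)]
  /((shuffle_mul (strip i f) g : W) + shuffle_mul f (strip i g)).
rewrite -[strip i (shuffle_mul g h)]
  /((shuffle_mul (strip i g) h : W) + shuffle_mul g (strip i h)).
rewrite (shuffle_mulC f (_ + _)) !shuffle_mulDl !wfD -!(shuffle_mulC f) !IH.
by rewrite addrA.
Qed.

Fact shuffle_mul1 : left_id shuffle_one (shuffle_mul : W -> W -> W).
Proof.
move=> f; apply/funext=> w; elim: w f => [|i w IH] f /=; first exact: mul1r.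
rewrite IH; have -> : strip i shuffle_one = 0 by [].
have mul0 g z : shuffle_mul 0 g z = 0.
  by elim: z g => [|j z IHz] g /=; rewrite ?mul0r // !IHz addr0.
by rewrite mul0 add0r.
Qed.

HB.instance Definition _ := GRing.Zmodule_isComPzRing.Build W
  shuffle_mulA shuffle_mulC shuffle_mul1 shuffle_mulDl.

Lemma shuffle_nil f g : (f * g) [::] = f [::] * g [::]. Proof. by []. Qed.

Lemma stripM i f g : strip i (f * g) = strip i f * g + f * strip i g.
Proof. by []. Qed.

Definition rstrip (i : 'I_n) (f : W) : W := fun w => f (rcons w i).

Definition derivation (D : W -> W) :=
  {morph D : f g / f + g} /\ forall f g, D (f * g) = D f * g + f * D g.

Lemma derivation_comm D E : derivation D -> derivation E ->
  derivation (fun f => D (E f) - E (D f)).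
Proof.
move=> [DD DM] [ED EM]; split=> f g; first by rewrite !(ED, DD) opprD addrACA.
rewrite !(EM, DM, ED, DD) mulrBl mulrBr !opprD !addrA.
by rewrite [LHS](ACl (1*5*4*8*(2*7)*(3*6)))/= !subrr !addr0.
Qed.

(** Right stripping commutes with the left stripping that defines the product, which reduces the
    rule to shorter words. *)
Lemma rstrip_derivation i : derivation (rstrip i).
Proof.
split=> // f g; apply/funext=> w; elim: w f g => [|j w IH] f g.
  by rewrite /rstrip /= wfD.
rewrite wfD -[LHS]/(rstrip i (strip j (f * g)) w) stripM.
rewrite -[LHS]/(rstrip i (strip j f * g) w + rstrip i (f * strip j g) w) !IH
  !wfD.
by rewrite addrACA.
Qed.

Fixpoint wsum (V : zmodType) (d : nat) (F : word -> V) : V :=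
  if d is d'.+1 then \sum_(i < n) wsum d' (fun t => F (i :: t)) else F [::].

Lemma eq_wsum (V : zmodType) d (F G : word -> V) :
  (forall t, size t = d -> F t = G t) -> wsum d F = wsum d G.
Proof.
elim: d F G => [|d IH] F G FG /=; first exact: FG.
by apply: eq_bigr => i _; apply: IH => t td; apply: FG; rewrite /= td.
Qed.

Lemma wsum0 (V : zmodType) d (F : word -> V) :
  (forall t, size t = d -> F t = 0) -> wsum d F = 0.
Proof.
elim: d F => [|d IH] F F0 /=; first exact: F0.
by rewrite big1 // => i _; apply: IH => t td; apply: F0; rewrite /= td.
Qed.

Lemma wsumD (V : zmodType) d (F G : word -> V) :
  wsum d (fun t => F t + G t) = wsum d F + wsum d G.
Proof.
elim: d F G => [//|d IH] F G /=; rewrite -big_split /=.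
by apply: eq_bigr => i _; apply: IH.
Qed.

Lemma wsumMl d a (F : word -> R) : wsum d (fun t => a * F t) = a * wsum d F.
Proof.
elim: d F => [//|d IH] F /=; rewrite mulr_sumr; apply: eq_bigr => i _;
  exact: IH.
Qed.

Lemma wsum_cat (V : zmodType) d e (F : word -> V) :
  wsum (d + e) F = wsum d (fun t => wsum e (fun t' => F (t ++ t'))).
Proof. by elim: d F => [//|d IH] F /=; apply: eq_bigr => i _; apply: IH. Qed.

Lemma wsumS (V : zmodType) d (F : word -> V) :
  wsum d.+1 F = \sum_(i < n) wsum d (fun t => F (i :: t)).
Proof. by []. Qed.

Lemma wsum_rcons (V : zmodType) d (F : word -> V) :
  wsum d.+1 F = wsum d (fun t => \sum_(i < n) F (rcons t i)).
Proof.
rewrite -addn1 wsum_cat; apply: eq_wsum => t _ /=.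
by apply: eq_bigr => i _; rewrite cats1.
Qed.

Lemma wsum_delta (F : word -> R) w :
  wsum (size w) (fun t => F t * (t == w)%:R) = F w.
Proof.
elim: w F => [|i w IH] F /=; first by rewrite mulr1.
rewrite (bigD1 i) //= big1 ?addr0 => [|j /negbTE ji].
  rewrite -(IH (fun t => F (i :: t))); apply: eq_wsum => t _.
  by rewrite eqseq_cons eqxx.
by apply: wsum0 => t _; rewrite eqseq_cons ji mulr0.
Qed.

(* The operator on W of the homogeneous noncommutative polynomial of degree d
   with coefficients c, where letters act by stripping from the right. *)
Definition wop (d : nat) (c : W) (f : W) : W := fun z =>
  wsum d (fun t => c t * f (z ++ t)).

Definition wmul (a : R) (f : W) : W := fun z => a * f z.

Lemma wmulA a f g : wmul a f * g = wmul a (f * g).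
Proof.
apply/funext=> z; rewrite [RHS]/wmul; elim: z f g => [|i z IH] f g.
  by rewrite shuffle_nil mulrA.
rewrite -[LHS]/((wmul a (strip i f) * g) z + (wmul a f * strip i g) z) !IH.
by rewrite -mulrDr.
Qed.

Lemma wmulDr a f g : wmul a (f + g) = wmul a f + wmul a g.
Proof. by apply/funext=> z; rewrite /wmul wfD mulrDr. Qed.

Lemma wmul_derivation a D : derivation D -> derivation (fun f => wmul a (D f)).
Proof.
move=> [DD DM]; split=> f g; first by rewrite DD wmulDr.
by rewrite DM wmulDr wmulA [f * wmul _ _]mulrC wmulA [D g * f]mulrC.
Qed.

Lemma derivationD D E : derivation D -> derivation E ->
  derivation (fun f => D f + E f).
Proof.
move=> [DD DM] [ED EM]; split=> f g; first by rewrite DD ED addrACA.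
by rewrite DM EM mulrDl mulrDr addrACA.
Qed.

Lemma wop_scale d a (c : W) : wop d (wmul a c) = fun f => wmul a (wop d c f).
Proof.
apply/funext=> f; apply/funext=> z; rewrite /wop /wmul -wsumMl.
by apply: eq_wsum => t _; rewrite mulrA.
Qed.

Lemma wop_add d (c c' : W) : wop d (c + c') = fun f => wop d c f + wop d c' f.
Proof.
apply/funext=> f; apply/funext=> z; rewrite wfD /wop -wsumD.
by apply: eq_wsum => t _; rewrite wfD mulrDl.
Qed.

Lemma derivation0 : derivation (fun=> 0).
Proof. by split=> f g; rewrite ?addr0 // mul0r mulr0 addr0. Qed.

Lemma wop0 d (c : W) : (forall t, size t = d -> c t = 0) -> wop d c = fun=> 0.
Proof.
move=> c0; apply/funext=> f; apply/funext=> z; apply: wsum0 => t td.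
by rewrite c0 ?mul0r.
Qed.

Let derivationX D f g m : derivation D ->
  D (f ^+ m.+1 * g) = D f * (f ^+ m * g) *+ m.+1 + f ^+ m.+1 * D g.
Proof.
move=> [_ DM]; elim: m => [|m IH]; first by rewrite expr1 expr0 mul1r mulr1n DM.
rewrite (exprS f m.+1) -mulrA DM IH mulrDr [in RHS]mulrS -!addrA; congr (_ + _).
by rewrite [f * (f ^+ m.+1 * _)]mulrA mulrnAr mulrCA [f * (f ^+ m * _)]mulrA
  -exprS.
Qed.

Hypothesis domR : forall a b : R, a * b = 0 -> a = 0 \/ b = 0.
Hypothesis charR : forall (a : R) m, a *+ m.+1 = 0 -> a = 0.

Section Divisibility.
Variables (d e : nat) (p q u : W).
Hypotheses (d_gt0 : (0 < d)%N) (e_gt0 : (0 < e)%N).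
Hypotheses (derp : derivation (wop (e + d) p)) (derq : derivation (wop d q)).
Hypothesis (q_neq0 : exists2 w, size w = d & q w <> 0).
Hypothesis pE : forall w z, size w = e -> size z = d -> p (w ++ z) = u w * q z.

Let Q := wop d q.
Let pair_u (f : W) : R := wsum e (fun w => u w * f w).

Let pair_uD f g : pair_u (f + g) = pair_u f + pair_u g.
Proof. by rewrite -wsumD; apply: eq_wsum => w _; rewrite wfD mulrDr. Qed.

Let pair_u0 : pair_u 0 = 0.
Proof. by apply: wsum0 => w _; rewrite mulr0. Qed.

Let pair_uMn f m : pair_u (f *+ m) = pair_u f *+ m.
Proof.
elim: m => [|m IH]; first exact: pair_u0.
by rewrite !mulrS pair_uD IH.
Qed.

Let pair_u_wmul a f : pair_u (wmul a f) = a * pair_u f.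
Proof. by rewrite -wsumMl; apply: eq_wsum => w _; rewrite /wmul mulrCA. Qed.

(** By [pE], the operator of [p] evaluated at the empty word is [pair_u] after [Q]; a derivation
    evaluated there kills products of two functions without constant term. *)
Let pair_uQ f g : f [::] = 0 -> g [::] = 0 -> pair_u (Q (f * g)) = 0.
Proof.
move=> f0 g0; have : wop (e + d) p (f * g) [::] = 0.
  by rewrite derp.2 wfD !shuffle_nil f0 g0 mulr0 mul0r addr0.
rewrite /wop wsum_cat => <-; apply: eq_wsum => w we.
by rewrite -wsumMl; apply: eq_wsum => z zd; rewrite pE ?mulrA.
Qed.

Let Q_low m f : (forall z, (m <= size z)%N -> f z = 0) ->
  forall z, (m.-1 <= size z)%N -> Q f z = 0.
Proof.
move=> f0 z mz; apply: wsum0 => t td; rewrite f0 ?mulr0 // size_cat td.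
by apply: leq_trans (leqSpred m) _; rewrite -addn1 leq_add.
Qed.

Let Q_nilpotent m f : (forall z, (m <= size z)%N -> f z = 0) -> iter m Q f = 0.
Proof.
elim: m f => [|m IH] f f0; first by apply/funext=> z; apply: f0.
by rewrite iterSr; apply/IH/(Q_low f0).
Qed.

(* For s the indicator function of a word w1 with q w1 <> 0, the derivation Q
   sends s to the scalar q w1. As in the slice theorem, every function without
   constant term is then, up to a scalar, the image under Q of a sum of
   products with s, whereas p = u q, being a derivation at the empty word,
   vanishes on such products. *)
Lemma wop_divisor w : size w = e -> u w = 0.
Proof.
move=> we; have [w1 w1d qw1] := q_neq0.
pose s : W := fun z => (z == w1)%:R; pose a : W := fun z => (z == w)%:R.
have Qs : Q s = wmul (q w1) 1.
  apply/funext=> -[|i z]; rewrite /wmul /Q /wop /=.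
    by rewrite -w1d (wsum_delta q) mulr1.
  rewrite mulr0; apply: wsum0 => t td; rewrite /s.
  case: eqP => [E|]; last by rewrite mulr0.
  by move: w1d; rewrite -E /= size_cat td => /eqP;
    rewrite -addSn -{2}[d]add0n eqn_add2r.
have s0 : s [::] = 0.
  by rewrite /s; case: eqP => // w10; move: d_gt0; rewrite -w1d -w10.
pose T i := s ^+ i * iter i Q a.
have T0 i : T i [::] = 0.
  case: i => [|i]; rewrite /T shuffle_nil.
    by rewrite /a /=; case: eqP => [w0|_]; rewrite ?mulr0 //; move: e_gt0;
      rewrite -we -w0.
  by rewrite exprS shuffle_nil s0 !mul0r.
(* By the Leibniz rule, [Q (s * T i)] is (i + 1) (q w1) T i + T (i + 1), and [pair_u] kills it. *)
have step i : q w1 * pair_u (T i) *+ i.+1 + pair_u (T i.+1) = 0.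
  rewrite -(pair_uQ s0 (T0 i)) /T mulrA -exprS derivationX //.
  by rewrite pair_uD pair_uMn Qs wmulA mul1r pair_u_wmul.
(* Descending induction on [i]: [Q] shortens supports and [a] lives in length [e], so [T i = 0] for
   [i > e]. At the other end [T 0] is [a], whose pairing with [u] is [u w]. *)
have uT i : pair_u (T i) = 0.
  have [m le_m] : exists m, (e < i + m)%N by exists e.+1;
    rewrite addnS ltnS leq_addl.
  elim: m i le_m => [|m IH] i le_m.
    rewrite addn0 in le_m; rewrite /T Q_nilpotent ?mulr0 ?pair_u0 // => z le_z.
    rewrite /a; case: eqP le_z => // ->; rewrite we => le_ie.
    by have := leq_trans le_m le_ie; rewrite ltnn.
  have := step i; rewrite (IH i.+1) ?addSnnS // addr0 => /charR /domR[]// /qw1.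
have := uT 0%N; rewrite /T expr0 mul1r /= /pair_u /a -we.
by rewrite (wsum_delta u).
Qed.

End Divisibility.
End ShuffleRing.

(** * Lie elements as derivations, and the Ore condition *)

Section LieElements.
Variables (k : fieldType) (n : nat).
Local Notation P := (freePoisson k n).
Local Notation U := (envelope P).
Local Notation word := (seq 'I_n).
Local Notation x_ i := (fp_gen i : P).

Definition gradient (a : P) : wordfun n P := fun w => wderiv w a.

(** Bracketing with x_j becomes the commutator with [rstrip j], and commutators of derivations are
    derivations. *)
Let wop_lieword w i : derivation (wop (size w).+1 (gradient (lieword k w i))).
Proof.
elim: w => [|j w IH].
  suff -> : wop 1 (gradient (lieword k [::] i)) = rstrip i.
    exact: rstrip_derivation.
  apply/funext=> f; apply/funext=> z; rewrite /wop /gradient /= (bigD1 i) //=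
    big1 => [|l /negbTE li].
    by rewrite wderiv_gen eqxx mul1r addr0 cats1.
  by rewrite wderiv_gen eqseq_cons li mul0r.
set D := wop _ _ in IH; set E := wop _ _.
suff -> : E = fun f => rstrip j (D f) - D (rstrip j f).
  exact: derivation_comm (rstrip_derivation _ j) IH.
pose c : wordfun n P := gradient (lieword k w i).
have cE z : gradient (lieword k (j :: w) i) z =
    (if z is l :: z' then (l == j)%:R * c z' else 0) -
    (if z is l :: z' then (last l z' == j)%:R * c (belast l z') else 0).
  rewrite /c /gradient /wderiv /= env_h_br ucoefB ucoef_gen ucoef_gen_r
    -/(wderiv _ _).
  by have [[b ->] _] := wderiv_lieword k z w i; rewrite pbr_scalar add0r.
apply/funext=> f; apply/funext=> z; rewrite wfB /E /wop.
under eq_wsum => t _ do rewrite cE mulrBl.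
rewrite wsumD; congr (_ + _).
  rewrite wsumS (bigD1 j) // big1 => [|l /negbTE lj]; last first.
    by apply: wsum0 => t _; rewrite lj !mul0r.
  by rewrite [LHS]addr0; apply: eq_wsum => t _; rewrite eqxx mul1r /= cat_rcons.
rewrite wsum_rcons.
have wsumN (d : nat) (F : word -> P) : wsum d (fun t => - F t) = - wsum d F.
  by rewrite -mulN1r -wsumMl; apply: eq_wsum => t _; rewrite mulN1r.
rewrite /D /wop -wsumN; apply: eq_wsum => t _.
rewrite (bigD1 j) //= big1 ?addr0 => [|l /negbTE lj].
  by case: t => [|l t] /=; rewrite ?last_rcons ?belast_rcons eqxx mul1r
    /rstrip rcons_cat.
by case: t => [|l' t] /=; rewrite ?last_rcons lj !mul0r oppr0.
Qed.

(** By the Leibniz rule, every gradient is a P-combination of gradients of Lie words, and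
    derivations form a P-module. *)
Lemma gradient_derivation d a : derivation (wop d (gradient a)).
Proof.
elim/freePoisson_lieword_ind: a => [w i | c | a b IHa IHb | a b IHa IHb].
- have [->|dw] := eqVneq d (size w).+1; first exact: wop_lieword.
  rewrite wop0; first exact: derivation0.
  move=> t td; have [_ grad0] := wderiv_lieword k t w i.
  by apply: grad0; rewrite td.
- rewrite wop0; first exact: derivation0.
  by move=> t _; apply: wderiv_const.
- have -> : gradient (a + b) = gradient a + gradient b.
    by apply/funext=> w; rewrite /gradient raddfD.
  by rewrite wop_add; apply: derivationD.
- have -> : gradient (a * b) = wmul a (gradient b) + wmul b (gradient a).
    by apply/funext=> w; rewrite /gradient wderivM.
  by rewrite wop_add !wop_scale; apply: derivationD; apply: wmul_derivation.
Qed.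

(** For a generator, b^2 h_(x_i) = (b h_(x_i) - {x_i, b}) b. Sums take a common denominator; in a
    product the denominator found for [v] serves as [b] for [u]. *)
Lemma ore_scalar (char0 : [pchar k] =i pred0) (u : U) (b : P) : b <> 0 ->
  exists s v, s <> 0 /\ env_m s * u = v * env_m b.
Proof.
elim/envelope_gen_ind: u b => [a | i | u v IHu IHv | u v IHu IHv] b b0.
- by exists b, (env_m a); split=> //; rewrite -!rmorphM mulrC.
- exists (b * b), (env_m b * env_h (x_ i) - env_m \{x_ i, b}); split.
    by move=> /(freePoisson_domain char0)[].
  rewrite mulrBl -(rmorphM (@env_m k P) \{_, _}) /= (mulrC \{_, _}) !rmorphM.
  by rewrite /= env_m_br mulrBr !mulrA subKr.
- have [[s [u' [s0 su]]] [t [v' [t0 tv]]]] := (IHu b b0, IHv b b0).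
  exists (s * t), (env_m t * u' + env_m s * v'); split.
    by move=> /(freePoisson_domain char0)[].
  by rewrite mulrDr mulrDl -!mulrA -su -tv !mulrA -!rmorphM (mulrC t).
- have [t [v' [t0 tv]]] := IHv b b0; have [s [u' [s0 su]]] := IHu t t0.
  by exists s, (u' * v'); split=> //; rewrite mulrA su -!mulrA tv.
Qed.

End LieElements.

(** * Elements with spanning differentials *)

Section SpanningDifferentials.
Variables (k : fieldType).
Hypothesis char0 : [pchar k] =i pred0.
Local Notation P := (freePoisson k 2).
Local Notation U := (envelope P).
Local Notation word := (seq 'I_2).
Local Notation x_ i := (fp_gen i : P).

Let dom (a b : P) : a * b = 0 -> a = 0 \/ b = 0.
Proof. exact: freePoisson_domain. Qed.

Let mulIn0 (a b : P) : a <> 0 -> b <> 0 -> a * b <> 0.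
Proof. by move=> a0 b0 /dom[]. Qed.

Let ucoef_x i w : ucoef (env_h (x_ i)) w = (w == [:: i])%:R.
Proof. by rewrite -(ucoef_hword k [:: i]) /hword big_seq1. Qed.

Lemma dle_lead2 (a b : U) : a = 0 /\ b = 0 \/
  exists e z, [/\ dle a e, dle b e, size z = e & ucoef a z <> 0 \/ ucoef b z <>
    0].
Proof.
have [->|[e [z [ae ze /eqP az]]]] := dle_lead a;
  have [->|[e' [z' [be ze' /eqP bz]]]] := dle_lead b; first by left.
- by right; exists e', z'; split=> //; [move=> w _; apply: ucoef0 | right].
- by right; exists e, z; split=> //; [move=> w _; apply: ucoef0 | left].
right; case: (leqP e e') => [le_e | /ltnW le_e].
  by exists e', z'; split=> //; [apply: dle_leq ae | right].
by exists e, z; split=> //; [apply: dle_leq be | left].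
Qed.

Section TopDegree.
Variables (f g : P).
Hypothesis span : forall i, exists a b : U, env_h (x_ i) = a * env_h f + b *
  env_h g.
Variables (N : nat) (w0 : word).
Hypotheses (N_gt1 : (1 < N)%N) (fN : dle (env_h f) N) (gN : dle (env_h g) N).
Hypotheses (w0N : size w0 = N) (fw0 : ucoef (env_h f) w0 <> 0).

Let ucoef_x0 i w : (1 < size w)%N -> ucoef (env_h (x_ i)) w = 0.
Proof. by rewrite ucoef_x; case: w => [|j [|l w]] //;
  rewrite eqseq_cons andbF. Qed.

(* The leading coefficients of h_f and h_g are proportional over P. *)
Let lower_degree : exists a b, b <> 0 /\
  dle (env_m a * env_h f + env_m b * env_h g) N.-1.
Proof.
have [a [b ab]] := span ord0.
have [[a0 b0]|[e [z [ae be ze abz]]]] := dle_lead2 a b.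
  have := ucoef_x ord0 [:: ord0]; rewrite ab a0 b0 !mul0r addr0 ucoef0 eqxx.
  by move=> /esym/eqP; rewrite oner_eq0.
(* At [z ++ w] both products show their top coefficients, whereas h_(x_0) has none beyond length
   1. *)
have dep w : size w = N ->
    ucoef a z * ucoef (env_h f) w + ucoef b z * ucoef (env_h g) w = 0.
  move=> wN; rewrite -(ucoefM ae fN) ?ze // -(ucoefM be gN) ?ze // -ucoefD -ab.
  by rewrite ucoef_x0 // size_cat wN (leq_trans N_gt1) // leq_addl.
exists (ucoef a z), (ucoef b z); split.
  move=> bz; have az : ucoef a z <> 0 by case: abz.
  by have := dep w0 w0N; rewrite bz mul0r addr0; apply: mulIn0.
move=> w; rewrite prednK ?(ltnW N_gt1) // ucoefD !ucoef_m.
rewrite leq_eqVlt => /predU1P[wN | ltN]; first exact: dep (esym wN).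
by rewrite fN // gN // !mulr0 addr0.
Qed.

Let derivation_grad (a b : P) d :
  derivation (wop d (ucoef (env_m a * env_h f + env_m b * env_h g))).
Proof.
have -> : ucoef (env_m a * env_h f + env_m b * env_h g) =
    wmul a (gradient f) + wmul b (gradient g).
  by apply/funext=> w; rewrite ucoefD !ucoef_m.
by rewrite wop_add !wop_scale; apply: derivationD; apply: wmul_derivation;
  apply: gradient_derivation.
Qed.

Lemma spanning_top_degree : False.
Proof.
have [a [b [b0 rN]]] := lower_degree.
set r := env_m a * env_h f + env_m b * env_h g in rN.
have r_nil : ucoef r [::] = 0.
  by rewrite ucoefD !ucoef_m -!/(wderiv _ _) !wderiv_nil !mulr0 addr0.
have r_der d : derivation (wop d (ucoef r)) by apply: derivation_grad.
(* This is absurd: [r] has no constant term, so its leading word would have to be [[:: i]] for both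
   values of [i]. *)
suff x_r i : exists s v, s <> 0 /\ env_m s * env_h (x_ i) = v * r.
  have [r0|[m [w1 [rm w1m /eqP rw1]]]] := dle_lead r.
    have [s [v [s0 /(congr1 (fun u => ucoef u [:: ord0]))]]] := x_r ord0.
    by rewrite r0 mulr0 ucoef0 ucoef_m ucoef_x eqxx mulr1.
  have w1E i : w1 = [:: i].
    have [s [v [s0 sv]]] := x_r i; have svE w := congr1 (fun u => ucoef u w) sv.
    have [v0|[e [z [ve ze /eqP vz]]]] := dle_lead v.
      have := svE [:: i]; rewrite v0 mul0r ucoef0 ucoef_m ucoef_x eqxx mulr1.
      by move/s0.
    have := svE (z ++ w1); rewrite /= (ucoefM ve rm) ?ze // ucoef_m ucoef_x.
    case: eqP => [|_]; last by rewrite mulr0 => /esym/(mulIn0 vz rw1).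
    case: z {ze vz} => [//|j [|l z]] // [_].
    by case: w1 {w1m} rw1 => //; rewrite r_nil.
  by have := w1E ord0; rewrite (w1E ord_max).
have [c [d cd]] := span i; have [s [v [s0 sv]]] := ore_scalar char0 d b0.
exists s, v; split=> //.
(* Eliminates h_g from s h_(x_i), using s d = v b and b h_g = r - a h_f. *)
set u := env_m s * c - v * env_m a.
have xE : env_m s * env_h (x_ i) = u * env_h f + v * r.
  rewrite cd mulrDr mulrBl mulrDr !mulrA sv addrA.
  by rewrite subrK.
suff u0 : u = 0 by rewrite xE u0 mul0r add0r.
have uv0 w : (1 < size w)%N -> ucoef (u * env_h f) w + ucoef (v * r) w = 0.
  by move=> w1; rewrite -ucoefD -xE ucoef_m ucoef_x0 ?mulr0.
(* Otherwise the leading terms of u h_f and v r cancel, so that the one of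
   h_f is, up to a scalar, a left multiple of the one of r; both are Lie
   elements. *)
have [//|[e [z [ue ze /eqP uz]]]] := dle_lead u; exfalso.
have sz_zw : (1 < size (z ++ w0))%N.
  by rewrite size_cat w0N (leq_trans N_gt1) ?leq_addl.
have uf_top : ucoef (u * env_h f) (z ++ w0) <> 0.
  by rewrite (ucoefM ue fN) ?ze //; apply: mulIn0.
have [v0|[e2 [z2 [ve ze2 /eqP vz]]]] := dle_lead v.
  by have := uv0 _ sz_zw; rewrite v0 mul0r ucoef0 addr0.
have [r0|[m [w1 [rm w1m /eqP rw1]]]] := dle_lead r.
  by have := uv0 _ sz_zw; rewrite r0 mulr0 ucoef0 addr0.
have m_gt0 : (0 < m)%N by rewrite -w1m; case: w1 {w1m} rw1 => //; rewrite r_nil.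
have m_ltN : (m < N)%N.
  rewrite ltnNge; apply/negP => le_Nm; apply: rw1; apply: rN; rewrite w1m.
  by rewrite prednK // (leq_trans _ N_gt1).
(* If [v * r] has the larger degree, nothing can cancel its leading coefficient. *)
have [lt_eN | le_eN] := ltnP (e + N) (e2 + m).
  have szw : size (z2 ++ w1) = (e2 + m)%N by rewrite size_cat ze2 w1m.
  have := uv0 (z2 ++ w1); rewrite szw (dleM ue fN) ?szw // add0r.
  rewrite (ucoefM ve rm) ?ze2 // => H; apply: (mulIn0 vz rw1); apply: H.
  by apply: leq_trans (ltnW lt_eN); rewrite (leq_trans N_gt1) ?leq_addl.
have v_le : dle v (e + (N - m)).
  apply: dle_leq ve; rewrite addnBA ?(ltnW m_ltN) // -(leq_add2r m) subnK //.
  by apply: leq_trans (ltnW m_ltN) _; apply: leq_addl.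
(* Fixing the prefix [z], at which [u] has a nonzero top coefficient, turns the cancellation into
   the factorization required by [wop_divisor]. *)
pose uc : wordfun 2 P := fun w => - ucoef v (z ++ w).
have char0P (c' : P) l : c' *+ l.+1 = 0 -> c' = 0.
  by move=> /eqP; rewrite -scaler_nat scaler_eq0 ((pcharf0P k).1 char0) => /eqP.
have pE w w' : size w = (N - m)%N -> size w' = m ->
    wmul (ucoef u z) (gradient f) (w ++ w') = uc w * ucoef r w'.
  move=> wN wm; apply/eqP; rewrite mulNr -addr_eq0 /wmul /gradient /wderiv.
  rewrite -(ucoefM ue fN) ?ze //; last by rewrite size_cat wN wm subnK ?(ltnW
    m_ltN).
  rewrite -(ucoefM v_le rm) ?size_cat ?ze ?wN // -catA; apply/eqP/uv0.
  by rewrite !size_cat wN wm subnK ?(ltnW m_ltN) // (leq_trans N_gt1) ?leq_addl.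
have uc0 : forall w, size w = (N - m)%N -> uc w = 0.
  apply: (wop_divisor dom char0P m_gt0 _ _ (r_der m) _ pE).
  - by rewrite subn_gt0.
  - by rewrite wop_scale; apply: wmul_derivation; apply: gradient_derivation.
  - by exists w1.
(* At [w0], the factorization now says that a product of two nonzero coefficients vanishes. *)
have := pE (take (N - m) w0) (drop (N - m) w0).
rewrite size_takel ?w0N ?leq_subr // size_drop w0N subKn ?(ltnW m_ltN) //.
rewrite cat_take_drop uc0 ?size_takel ?w0N ?leq_subr // mul0r => /(_ erefl
  erefl).
exact: mulIn0.
Qed.

End TopDegree.
(** Whichever of h_f and h_g attains the common degree bound plays the role of [f] in
    [spanning_top_degree]. *)
Lemma spanning_wderiv_eq0 (f g : P) :
  (forall i, exists a b : U, env_h (x_ i) = a * env_h f + b * env_h g) ->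
  forall w, (1 < size w)%N -> wderiv w f = 0 /\ wderiv w g = 0.
Proof.
move=> span.
have span' i : exists a b : U, env_h (x_ i) = a * env_h g + b * env_h f.
  by have [a [b ->]] := span i; exists b, a; rewrite addrC.
rewrite /wderiv => w w1.
have [[-> ->]|[N [z [fN gN zN fgz]]]] := dle_lead2 (env_h f) (env_h g).
  by rewrite !ucoef0.
have [N1 | N_gt1] := leqP N 1.
  by rewrite fN ?gN // (leq_ltn_trans N1).
exfalso; case: fgz => fgz; first exact: (spanning_top_degree span N_gt1 fN gN
  zN fgz).
exact: (spanning_top_degree span' N_gt1 gN fN zN fgz).
Qed.

End SpanningDifferentials.

(** * Jacobian matrices and the two implications *)

Section Jacobians.
Variables (k : fieldType) (n : nat).
Local Notation P := (freePoisson k n).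
Local Notation U := (envelope P).
Local Notation A := {mpoly k[n]}.
Local Notation x_ i := (fp_gen i : P).

Lemma fox_poly (p : A) j : fox (fp_poly p) j = env_m (fp_poly p^`M(j)).
Proof.
apply: (@fox_unique k n _ (fun j => env_m (fp_poly p^`M(j)))).
by rewrite -foxP env_h_poly.
Qed.

(** A ring morphism that kills every h_a: the bracket terms that arise in products die under
    [fp_ab]. It takes the Fox derivatives of a polynomial to its classical partial derivatives. *)
Definition aug (u : U) : A := fp_ab (ucoef u [::]).

Lemma augD u v : aug (u + v) = aug u + aug v.
Proof. by rewrite /aug ucoefD rmorphD. Qed.

Lemma aug_sum (I : Type) (r : seq I) (F : I -> U) :
  aug (\sum_(i <- r) F i) = \sum_(i <- r) aug (F i).
Proof. by rewrite /aug ucoef_sum rmorph_sum. Qed.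

Lemma aug_m a : aug (env_m a) = fp_ab a.
Proof. by rewrite /aug -[env_m a]mulr1 ucoef_m ucoef1 mulr1. Qed.

Lemma augM u v : aug (u * v) = aug u * aug v.
Proof.
elim/envelope_left_ind: u => [|a u IH|i u IH|u w IHu IHw].
- by rewrite mul1r /aug ucoef1 rmorph1 mul1r.
- have aug_mM w : aug (env_m a * w) = fp_ab a * aug w.
    by rewrite /aug ucoef_m rmorphM.
  by rewrite -mulrA !aug_mM IH mulrA.
- by rewrite -mulrA /aug !ucoef_gen !addr0 !fp_ab_br mul0r.
- by rewrite mulrDl !augD IHu IHw mulrDl.
Qed.

End Jacobians.

Section Corollary.
Variable k : fieldType.
Local Notation P := (freePoisson k 2).
Local Notation A := {mpoly k[2]}.
Local Notation x_ i := (fp_gen i : P).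

(** The Poisson endomorphism [psi] with the values of [phi] on the generators has the image of the
    Jacobian matrix of [phi] as its own, and the inverse of [psi] descends along [fp_ab]. *)
Lemma poisson_to_polynomial :
  (forall psi : {pmorphism P -> P},
     mx_invertible (poisson_jacobian psi) -> bijective psi) ->
  forall phi : {lrmorphism A -> A}, mpoly_jacobian phi \in unitmx -> bijective
    phi.
Proof.
move=> Ha phi Jphi; pose psi : {pmorphism P -> P} := fp_lift (fun i => fp_poly
  (phi 'X_i) : P).
have psi_poly p : psi (fp_poly p) = fp_poly (phi p).
  elim/mpoly_gen_ind: p => [i | c | p q IHp IHq | p q IHp IHq].
  - by rewrite fp_poly_gen /psi /= fp_lift_gen.
  - by rewrite !rmorph_alg.
  - by rewrite !rmorphD /= IHp IHq.
  - by rewrite !rmorphM /= IHp IHq.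
have ab_psi a : fp_ab (psi a) = phi (fp_ab a).
  elim/freePoisson_ind: a => [i | c | a b IHa IHb | a b IHa IHb | a b _ _].
  - by rewrite /psi /= fp_lift_gen fp_polyK fp_ab_gen.
  - by rewrite !rmorph_alg.
  - by rewrite !rmorphD /= IHa IHb.
  - by rewrite !rmorphM /= IHa IHb.
  - by rewrite /psi pbr_morph !fp_ab_br rmorph0.
pose emb : {rmorphism A -> envelope P} := @env_m k P \o @fp_poly k 2.
have Jpsi : poisson_jacobian psi = map_mx emb (mpoly_jacobian phi).
  by apply/matrixP=> i j; rewrite !mxE /psi /= fp_lift_gen fox_poly.
have [|psi' psiK psi'K] := Ha psi.
  exists (map_mx emb (invmx (mpoly_jacobian phi))).
  by rewrite Jpsi -!map_mxM mulmxV // mulVmx // map_mx1.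
exists (fun p => fp_ab (psi' (fp_poly p))) => p.
  by rewrite -psi_poly psiK fp_polyK.
by rewrite -ab_psi psi'K fp_polyK.
Qed.

Lemma polynomial_to_poisson (char0 : [pchar k] =i pred0) :
  (forall phi : {lrmorphism A -> A},
     mpoly_jacobian phi \in unitmx -> bijective phi) ->
  forall psi : {pmorphism P -> P},
    mx_invertible (poisson_jacobian psi) -> bijective psi.
Proof.
move=> Hb psi [B [_ BJ]].
(* The rows of [B] invert the system that expresses the h_(psi x_j) in the h_(x_l). *)
have span i : exists a b, env_h (x_ i) =
    a * env_h (psi (x_ ord0)) + b * env_h (psi (x_ ord_max)).
  exists (B i ord0), (B i ord_max).
  transitivity (\sum_j B i j * env_h (psi (x_ j))); last first.
    rewrite !big_ord_recl big_ord0 addr0; congr (_ + _ * env_h (psi (x_ _))).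
      by congr (B i _); apply/val_inj.
    exact/val_inj.
  transitivity (\sum_l (B *m poisson_jacobian psi) i l * env_h (x_ l)).
    rewrite BJ (bigD1 i) //= mxE eqxx mul1r big1 ?addr0 // => l /negbTE li.
    by rewrite mxE eq_sym li mul0r.
  under eq_bigr => l _ do rewrite mxE mulr_suml.
  rewrite exchange_big; apply: eq_bigr => j _ /=.
  rewrite (foxP (psi (x_ j))) mulr_sumr; apply: eq_bigr => l _.
  by rewrite mxE mulrA.
have psi_x i : fp_poly (fp_ab (psi (x_ i))) = psi (x_ i).
  apply: (wderiv_polyP char0) => w w1.
  have [f0 g0] := spanning_wderiv_eq0 char0 span w1.
  have [->//|i0] := eqVneq i ord0; suff -> : i = ord_max by [].
  by apply/val_inj; case: i i0 => -[|[|]].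
have [phi phiE] : exists phi : {lrmorphism A -> A},
    forall p, phi p = fp_ab (psi (fp_poly p)).
  by exists (@fp_ab k 2 \o psi \o @fp_poly k 2).
have psi_poly p : psi (fp_poly p) = fp_poly (phi p).
  elim/mpoly_gen_ind: p => [i | c | p q IHp IHq | p q IHp IHq].
  - by rewrite phiE fp_poly_gen psi_x.
  - by rewrite !rmorph_alg.
  - by rewrite !rmorphD /= IHp IHq.
  - by rewrite !rmorphM /= IHp IHq.
have [|phi' phiK phi'K] := Hb phi.
  have Jphi i j : aug (poisson_jacobian psi i j) = mpoly_jacobian phi i j.
    rewrite !mxE -psi_x fox_poly aug_m fp_polyK.
    by rewrite phiE fp_poly_gen.
  (* Over a commutative ring, the left inverse obtained by applying [aug] to [B] suffices. *)
  suff: map_mx (@aug k 2) B *m mpoly_jacobian phi = 1%:M by case/mulmx1_unit.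
  apply/matrixP=> i j; rewrite mxE.
  transitivity (aug ((B *m poisson_jacobian psi) i j)).
    by rewrite mxE aug_sum; apply: eq_bigr => l _; rewrite augM Jphi mxE.
  by rewrite BJ !mxE -(rmorph_nat (@env_m k P)) aug_m rmorph_nat.
(* The inverse of [psi] is the Poisson extension of [phi']. As [phi'] is a bare function, its
   compatibility with the operations comes from the injectivity of [phi]. *)
pose chi : {pmorphism P -> P} := fp_lift (fun i => fp_poly (phi' 'X_i) : P).
have phi_inj := can_inj phiK.
have chi_poly p : chi (fp_poly p) = fp_poly (phi' p).
  elim/mpoly_gen_ind: p => [i | c | p q IHp IHq | p q IHp IHq].
  - by rewrite fp_poly_gen /chi /= fp_lift_gen.
  - have -> : phi' c%:A = c%:A by apply: phi_inj; rewrite phi'K rmorph_alg.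
    by rewrite !rmorph_alg.
  - have -> : phi' (p + q) = phi' p + phi' q.
      by apply: phi_inj; rewrite rmorphD /= !phi'K.
    by rewrite !rmorphD /= IHp IHq.
  - have -> : phi' (p * q) = phi' p * phi' q.
      by apply: phi_inj; rewrite rmorphM /= !phi'K.
    by rewrite !rmorphM /= IHp IHq.
exists chi; elim/freePoisson_ind => [i|c|a b IHa IHb|a b IHa IHb|a b IHa IHb].
- by rewrite -[x_ i]fp_poly_gen psi_poly chi_poly phiK.
- by rewrite !rmorph_alg.
- by rewrite !rmorphD /= IHa IHb.
- by rewrite !rmorphM /= IHa IHb.
- by rewrite /chi !pbr_morph -/chi IHa IHb.
- by rewrite -[x_ i]fp_poly_gen chi_poly psi_poly phi'K.
- by rewrite !rmorph_alg.
- by rewrite !rmorphD /= IHa IHb.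
- by rewrite !rmorphM /= IHa IHb.
- by rewrite /chi !pbr_morph -/chi IHa IHb.
Qed.

End Corollary.

Theorem corollary5 (k : fieldType) (char0 : [pchar k] =i pred0) :
  (forall psi : {pmorphism freePoisson k 2 -> freePoisson k 2},
     mx_invertible (poisson_jacobian psi) -> bijective psi)
  <->
  (forall phi : {lrmorphism {mpoly k[2]} -> {mpoly k[2]}},
     mpoly_jacobian phi \in unitmx -> bijective phi).
Proof.
split; first exact: poisson_to_polynomial.
exact: polynomial_to_poisson.
Qed.
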